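(* Let $\mathbb{G}$ be a finite quantum group with dual $\widehat{\mathbb{G}}$. The compact quantum groups $\mathrm{qAut}(\mathbb{G})$ and $\mathrm{qAut}(\widehat{\mathbb{G}})$ are (canonically) isomorphic.
   Context: Finite quantum group: $\mathbb{G}$ is given by a finite-dimensional $\mathrm{C}^*$-algebra $\mathrm{C}(\mathbb{G})$ which is a Hopf $*$-algebra with coproduct $\Delta$, antipode $S$, counit $\epsilon$ and Haar state $h$ (the unique bi-invariant state; it is a faithful trace, and $S$ is involutive and commutes with $*$). Convolution product: $a\star b=(h\otimes\mathrm{id})\bigl(((S\otimes\mathrm{id})\Delta(b))(a\otimes\mathbb{1})\bigr)$; convolution adjoint: $a^\bullet=S(a^* )$; Haar element: the unique $\eta\in\mathrm{C}(\mathbb{G})$ with $\epsilon(\eta)=1$ and $a\eta=\epsilon(a)\eta$ for all $a\in\mathrm{C}(\mathbb{G})$. Dual $\widehat{\mathbb{G}}$: the finite quantum group with $\mathrm{C}(\widehat{\mathbb{G}})=\mathrm{C}(\mathbb{G})^*=\{h(\cdot\,a): a\in\mathrm{C}(\mathbb{G})\}$, product $\omega_1\omega_2=(\omega_1\otimes\omega_2)\circ\Delta$, unit $\epsilon$, involution $\omega^*(a)=\overline{\omega(S(a)^* )}$, coproduct $\widehat{\Delta}(\omega)(c_1\otimes c_2)=\omega(c_1c_2)$, counit $\omega\mapsto\omega(\mathbb{1})$, antipode $\widehat{S}(\omega)=\omega\circ S$, Haar state $\widehat{h}(h(\cdot\,a))=h(\eta)\epsilon(a)$. For a unital $\mathrm{C}^*$-algebra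 $\mathsf{B}$, a linear map $\alpha\colon\mathrm{C}(\mathbb{G})\to\mathrm{C}(\mathbb{G})\otimes\mathsf{B}$ represents a quantum family of automorphisms of $\mathbb{G}$ (indexed by $\mathsf{B}$) if it is a unital $*$-homomorphism, satisfies the Podleś condition ($\alpha(\mathrm{C}(\mathbb{G}))(\mathbb{1}\otimes\mathsf{B})$ spans $\mathrm{C}(\mathbb{G})\otimes\mathsf{B}$), preserves the convolution product (is a homomorphism from $(\mathrm{C}(\mathbb{G}),\star)$ to $\mathrm{C}(\mathbb{G})\otimes\mathsf{B}$ with product $(a\otimes b)(a'\otimes b')=(a\star a')\otimes bb'$), preserves the convolution adjoint ($(\bullet\otimes * )\circ\alpha=\alpha\circ\bullet$) and preserves the Haar element ($\alpha(\eta)=\eta\otimes\mathbb{1}_{\mathsf{B}}$). For any finite quantum group $\mathbb{G}$ there is a universal pair $(\mathsf{B}_u,\boldsymbol{\alpha}_u)$, unique up to isomorphism: $\boldsymbol{\alpha}_u$ represents a quantum family of automorphisms of $\mathbb{G}$ indexed by the unital $\mathrm{C}^*$-algebra $\mathsf{B}_u$, and for every unital $\mathrm{C}^*$-algebra $\mathsf{B}$ and every $\alpha\colon\mathrm{C}(\mathbb{G})\to\mathrm{C}(\mathbb{G})\otimes\mathsf{B}$ representing a quantum family of automorphisms of $\mathbb{G}$ there is a unique unital $*$-homomorphism $\Lambda\colon\mathsf{B}_u\to\mathsf{B}$ with $\alpha=(\mathrm{id}\otimes\Lambda)\circ\boldsymbol{\alpha}_u$. Moreover $\mathsf{B}_u$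 carries a unique coproduct $\Delta_u\colon\mathsf{B}_u\to\mathsf{B}_u\otimes\mathsf{B}_u$ (spatial tensor product) making it the algebra of continuous functions on a compact quantum group (in the sense of Woronowicz), such that $\boldsymbol{\alpha}_u$ is an action of it on $\mathbb{G}$, i.e. $(\mathrm{id}\otimes\Delta_u)\circ\boldsymbol{\alpha}_u=(\boldsymbol{\alpha}_u\otimes\mathrm{id})\circ\boldsymbol{\alpha}_u$. This compact quantum group is denoted $\mathrm{qAut}(\mathbb{G})$ and called the quantum automorphism group of $\mathbb{G}$; $\mathrm{qAut}(\widehat{\mathbb{G}})$ is the same construction applied to $\widehat{\mathbb{G}}$. *)

(* Defs.v *)
From HB Require Import structures.
From mathcomp Require Import all_boot all_order all_algebra.
From mathcomp Require Import sesquilinear complex.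
From mathcomp Require Import all_classical all_reals all_analysis.

Set Implicit Arguments.
Unset Strict Implicit.
Unset Printing Implicit Defensive.
Import Order.TTheory GRing.Theory Num.Theory.
Import numFieldNormedType.Exports.
Local Open Scope classical_set_scope.
Local Open Scope ring_scope.

(** * Tensor products with a finite-dimensional left factor *)

(* With (e_i) the basis [vbasis fullv] of A, the algebraic tensor product of A
   and B is modelled by the families (b_i), which stand for
   \sum_i e_i (x) b_i. *)
Notation tens A B := {ffun 'I_(\dim (fullv : {vspace A})) -> B}.

Definition tpure (K : fieldType) (A : vectType K) (B : lmodType K)
    (a : A) (b : B) : tens A B :=
  [ffun i => coord (vbasis fullv) i a *: b].

Notation "a ⊗ b" := (tpure a b) (at level 45, left associativity).

(* Sweedler-style elimination: for f bilinear, [tlift f] is the linear map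
   a ⊗ b |-> f a b. It is also correct when f is antilinear in both
   arguments. *)
Definition tlift (K : fieldType) (A : vectType K) (B : lmodType K)
    (V : nmodType) (f : A -> B -> V) (t : tens A B) : V :=
  \sum_(i < \dim (fullv : {vspace A})) f (vbasis fullv)`_i (t i).

Definition tmap (K : fieldType) (A A' : vectType K) (B B' : lmodType K)
    (f : A -> A') (g : B -> B') : tens A B -> tens A' B' :=
  tlift (fun a b => f a ⊗ g b).

(* the product (a ⊗ b) (a' ⊗ b') = mA a a' ⊗ mB b b' *)
Definition tmul (K : fieldType) (A : vectType K) (B : lmodType K)
    (mA : A -> A -> A) (mB : B -> B -> B) (t t' : tens A B) : tens A B :=
  tlift (fun a b => tlift (fun a' b' => mA a a' ⊗ mB b b') t') t.

Definition lspan (K : fieldType) (V : lmodType K) (X : set V) : set V :=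
  [set x | exists (n : nat) (c : 'I_n -> K) (v : 'I_n -> V),
     (forall k, X (v k)) /\ x = \sum_k c k *: v k].

(** * Unital C*-algebras *)

(* The norm is a bare real-valued function: MathComp's hierarchy has no
   structure joining its rings with its normed modules. *)
HB.mixin Record isCStarAlgebra (R : realType) A of GRing.Algebra R[i] A := {
  adj : A -> A ;
  cnorm : A -> R ;
  adj_antilinear : forall (c : R[i]) (x y : A),
    adj (c *: x + y) = c^* *: adj x + adj y ;
  adjM : forall x y : A, adj (x * y) = adj y * adj x ;
  adjK : involutive adj ;
  cnorm0_eq0 : forall x : A, cnorm x = 0 -> x = 0 ;
  cnormZ : forall (c : R[i]) (x : A),
    (cnorm (c *: x))%:C%C = `|c| * (cnorm x)%:C%C ;
  ler_cnormD : forall x y : A, cnorm (x + y) <= cnorm x + cnorm y ;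
  ler_cnormM : forall x y : A, cnorm (x * y) <= cnorm x * cnorm y ;
  cnorm_adjM : forall x : A, cnorm (adj x * x) = cnorm x ^+ 2 ;
  cnorm_complete : forall u : nat -> A,
    (forall e : R, 0 < e -> exists N : nat, forall m n : nat,
       (N <= m)%N -> (N <= n)%N -> cnorm (u m - u n) < e) ->
    exists l : A, forall e : R, 0 < e -> exists N : nat, forall n : nat,
      (N <= n)%N -> cnorm (u n - l) < e
}.

#[short(type="cstarType")]
HB.structure Definition CStarAlgebra (R : realType) :=
  {A of GRing.Algebra R[i] A & isCStarAlgebra R A}.

Definition cstar_dense (R : realType) (A : cstarType R) (X : set A) : Prop :=
  forall (x : A) (e : R), 0 < e -> exists2 y, X y & cnorm (x - y) < e.

Definition star_hom (R : realType) (A B : cstarType R) (f : A -> B) : Prop :=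
  [/\ linear f, monoid_morphism f & forall x, f (adj x) = adj (f x)].

(** * Spatial tensor product of unital C*-algebras *)

Record hilbert (R : realType) := Hilbert {
  hilbert_space :> completeNormedModType R[i] ;
  ip : {dot hilbert_space for (@Num.conj R[i])} ;
  ip_norm : forall x : hilbert_space, ip x x = `|x| ^+ 2
}.

(* The operators are automatically bounded since A is a C*-algebra. *)
Definition cstar_rep (R : realType) (A : cstarType R) (H : hilbert R)
    (pi : A -> H -> H) : Prop :=
  [/\ forall a, linear (pi a),
      forall x, linear (pi^~ x),
      forall x, pi 1 x = x,
      forall a b x, pi (a * b) x = pi a (pi b x)
    & forall a x y, ip H (pi a x) y = ip H x (pi (adj a) y)].

(* The operator norm of (pi (x) rho) (\sum_k a_k (x) b_k) on the Hilbert space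
   tensor product of H and K is at most c: the sums are the squared norms of
   the image of the vector \sum_l x_l (x) y_l and of that vector. *)
Definition rep_norm_le (R : realType) (A B : cstarType R) (H K : hilbert R)
    (pi : A -> H -> H) (rho : B -> K -> K) (n : nat)
    (a : 'I_n -> A) (b : 'I_n -> B) (c : R) : Prop :=
  forall (m : nat) (x : 'I_m -> H) (y : 'I_m -> K),
    \sum_k \sum_l \sum_k' \sum_l'
       ip H (pi (a k) (x l)) (pi (a k') (x l')) *
       ip K (rho (b k) (y l)) (rho (b k') (y l'))
    <= (c ^+ 2)%:C%C * \sum_l \sum_l' ip H (x l) (x l') * ip K (y l) (y l').

(* (T, i, j) is the spatial tensor product of A and B, where
   i a = a (x) 1 and j b = 1 (x) b: the elementary tensors i a * j b span a
   dense subspace, on which the norm is the supremum of the norms in the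
   representations pi (x) rho. *)
Definition spatial_tensor (R : realType) (A B T : cstarType R)
    (i : A -> T) (j : B -> T) : Prop :=
  [/\ star_hom i, star_hom j,
      forall a b, i a * j b = j b * i a,
      cstar_dense (lspan [set x | exists a b, x = i a * j b])
    & forall (n : nat) (a : 'I_n -> A) (b : 'I_n -> B) (c : R), 0 <= c ->
        cnorm (\sum_k i (a k) * j (b k)) <= c <->
        forall (H K : hilbert R) (pi : A -> H -> H) (rho : B -> K -> K),
          cstar_rep pi -> cstar_rep rho -> rep_norm_le pi rho a b c].

(* F is the unital *-homomorphism with F (a (x) b) = f a * g b; it is unique
   when (T, i, j) is a spatial tensor product. *)
Definition tensor_hom (R : realType) (A B T T' : cstarType R)
    (i : A -> T) (j : B -> T) (f : A -> T') (g : B -> T') (F : T -> T') : Prop :=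
  [/\ star_hom F, forall a, F (i a) = f a & forall b, F (j b) = g b].

(** * Compact quantum groups *)

(* (Delta (x) id) \o Delta = (id (x) Delta) \o Delta. The triple tensor product
   T3 is (B (x) B) (x) B with l t = t (x) 1 and r b = 1 (x) 1 (x) b, and
   leg23 t = 1 (x) t. *)
Definition cqg_coassociative (R : realType) (B T : cstarType R)
    (i j : B -> T) (Delta : B -> T) : Prop :=
  exists (T3 : cstarType R) (l : T -> T3) (r : B -> T3)
         (leg23 Delta_id id_Delta : T -> T3),
    [/\ spatial_tensor l r,
        tensor_hom i j (l \o j) r leg23,
        tensor_hom i j (l \o Delta) r Delta_id,
        tensor_hom i j (l \o i) (leg23 \o Delta) id_Delta
      & Delta_id \o Delta = id_Delta \o Delta].

Record cqg (R : realType) := CQG {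
  cqg_alg :> cstarType R ;
  cqg_tens : cstarType R ;
  leg1 : cqg_alg -> cqg_tens ;
  leg2 : cqg_alg -> cqg_tens ;
  cqg_coprod : cqg_alg -> cqg_tens ;
  cqg_spatial : spatial_tensor leg1 leg2 ;
  cqg_coprod_hom : star_hom cqg_coprod ;
  cqg_coassoc : cqg_coassociative leg1 leg2 cqg_coprod ;
  cqg_density1 :
    cstar_dense (lspan [set x | exists a b, x = cqg_coprod a * leg1 b]) ;
  cqg_density2 :
    cstar_dense (lspan [set x | exists a b, x = cqg_coprod a * leg2 b])
}.

Definition cqg_iso (R : realType) (Q Q' : cqg R) (L : Q -> Q') : Prop :=
  [/\ star_hom L, bijective L
    & exists2 LL : cqg_tens Q -> cqg_tens Q',
        tensor_hom (@leg1 R Q) (@leg2 R Q)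
                   (@leg1 R Q' \o L) (@leg2 R Q' \o L) LL
      & LL \o @cqg_coprod R Q = @cqg_coprod R Q' \o L].

(** * Finite quantum groups *)

(* The bare data; the axioms are in [finite_quantum_group]. *)
Record hopf_data (R : realType) := HopfData {
  hopf_space :> vectType R[i] ;
  hmul : hopf_space -> hopf_space -> hopf_space ;
  hone : hopf_space ;
  hstar : hopf_space -> hopf_space ;
  coprod : 'Hom(hopf_space, tens hopf_space hopf_space) ;
  counit : 'Hom(hopf_space, R[i]^o) ;
  antipode : 'End(hopf_space) ;
  haar : 'Hom(hopf_space, R[i]^o)
}.
Arguments hone {R h}.

(* A finite-dimensional *-algebra has at most one C*-norm, so having one is a
   property of the *-algebra. *)
Definition hopf_cstar (R : realType) (G : hopf_data R) : Prop :=
  exists (A : cstarType R) (f : G -> A),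
    [/\ linear f, bijective f,
        forall x y, f (hmul x y) = f x * f y,
        f hone = 1
      & forall x, f (hstar x) = adj (f x)].

Record finite_quantum_group (R : realType) (G : hopf_data R) : Prop := {
  fqg_cstar : hopf_cstar G ;
  fqg_coprod1 : coprod G hone = hone ⊗ hone ;
  fqg_coprodM : forall x y,
    coprod G (hmul x y) = tmul (@hmul R G) (@hmul R G) (coprod G x) (coprod G y) ;
  fqg_coprod_star : forall x,
    coprod G (hstar x) = tmap (@hstar R G) (@hstar R G) (coprod G x) ;
  fqg_coassoc : forall x,
    tlift (fun x1 x2 => tlift (fun y1 y2 => y1 ⊗ (y2 ⊗ x2)) (coprod G x1))
          (coprod G x)
    = tmap idfun (coprod G) (coprod G x) ;
  fqg_counitl : forall x, tlift (fun x1 x2 => counit G x1 *: x2) (coprod G x) = x ;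
  fqg_counitr : forall x, tlift (fun x1 x2 => counit G x2 *: x1) (coprod G x) = x ;
  fqg_counit1 : counit G hone = 1 ;
  fqg_counitM : forall x y,
    counit G (hmul x y) = (counit G x : R[i]) * counit G y ;
  fqg_counit_star : forall x, counit G (hstar x) = (counit G x : R[i])^* ;
  fqg_antipodel : forall x,
    tlift (fun x1 x2 => hmul (antipode G x1) x2) (coprod G x)
    = counit G x *: hone ;
  fqg_antipoder : forall x,
    tlift (fun x1 x2 => hmul x1 (antipode G x2)) (coprod G x)
    = counit G x *: hone ;
  fqg_antipodeK : involutive (antipode G) ;
  fqg_antipode_star : forall x, antipode G (hstar x) = hstar (antipode G x) ;
  fqg_haar1 : haar G hone = 1 ;
  fqg_haar_ge0 : forall x, 0 <= (haar G (hmul (hstar x) x) : R[i]) ;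
  fqg_haarl : forall x,
    tlift (fun x1 x2 => haar G x1 *: x2) (coprod G x) = haar G x *: hone ;
  fqg_haarr : forall x,
    tlift (fun x1 x2 => haar G x2 *: x1) (coprod G x) = haar G x *: hone ;
  fqg_haar_faithful : forall x, haar G (hmul (hstar x) x) = 0 -> x = 0 ;
  fqg_haar_trace : forall x y, haar G (hmul x y) = haar G (hmul y x)
}.

Definition convol (R : realType) (G : hopf_data R) (a b : G) : G :=
  tlift (fun b1 b2 => haar G (hmul (antipode G b1) a) *: b2) (coprod G b).

Definition convol_adj (R : realType) (G : hopf_data R) (a : G) : G :=
  antipode G (hstar a).

(* Defined by description: such an element exists and is unique for a finite
   quantum group. *)
Definition haar_elt (R : realType) (G : hopf_data R) : G :=
  xget 0 [set e : G | counit G e = 1 /\ forall a, hmul a e = counit G a *: e].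

(** * The dual *)

(* a |-> h(. a) *)
Definition fourier (R : realType) (G : hopf_data R) :
    'Hom(G, 'Hom(G, R[i]^o)) :=
  linfun (fun a : G => linfun (fun x : G => haar G (hmul x a))
                         : 'Hom(G, R[i]^o)).

(* If G is a finite quantum group, all arguments of [linfun] below are linear
   and [fourier G] is bijective. In [dual_coprod], the e^k are the coordinate
   functionals, so the value on c1 ⊗ c2 is
   \sum_k e^k(c1) w(e_k c2) = w(c1 c2). *)
Section Dual.
Variables (R : realType) (G : hopf_data R).
Local Notation C := R[i]^o.
Local Notation D := 'Hom(G, R[i]^o).

Definition dual_mul (w1 w2 : D) : D :=
  linfun (fun x : G =>
    tlift (fun x1 x2 => (w1 x1 : R[i]) * w2 x2 : C) (coprod G x)).

Definition dual_star (w : D) : D :=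
  linfun (fun a : G => (w (hstar (antipode G a)) : R[i])^* : C).

Definition dual_coprod : 'Hom(D, tens D D) :=
  linfun (fun w : D =>
    \sum_(k < \dim (fullv : {vspace G}))
      ((linfun (coord (vbasis (fullv : {vspace G})) k : G -> C) : D)
       ⊗ (linfun (fun c : G => w (hmul (vbasis fullv)`_k c)) : D))).

Definition dual_counit : 'Hom(D, C) := linfun (fun w : D => w hone).

Definition dual_antipode : 'End(D) :=
  linfun (fun w : D => linfun (fun a : G => w (antipode G a)) : D).

Definition dual_haar : 'Hom(D, C) :=
  linfun (fun w : D =>
    (haar G (haar_elt G) : R[i]) * counit G ((fourier G)^-1%VF w) : C).

Definition dual : hopf_data R :=
  @HopfData R 'Hom(G, R[i]^o) dual_mul (counit G) dual_star
    dual_coprod dual_counit dual_antipode dual_haar.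

Definition to_dual (a : G) : dual := fourier G a.
End Dual.

(** * Quantum automorphism groups *)

Record quantum_family (R : realType) (G : hopf_data R) (B : cstarType R)
    (alpha : G -> tens G B) : Prop := {
  qf_linear : linear alpha ;
  qf_one : alpha hone = hone ⊗ 1 ;
  qf_mul : forall x y,
    alpha (hmul x y) = tmul (@hmul R G) *%R (alpha x) (alpha y) ;
  qf_star : forall x, alpha (hstar x) = tmap (@hstar R G) adj (alpha x) ;
  qf_podles :
    lspan [set t | exists x b,
             t = tmul (@hmul R G) *%R (alpha x) (hone ⊗ b)] = setT ;
  qf_convol : forall x y,
    alpha (convol x y) = tmul (@convol R G) *%R (alpha x) (alpha y) ;
  qf_convol_adj : forall x,
    tmap (@convol_adj R G) adj (alpha x) = alpha (convol_adj x) ;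
  qf_haar_elt : alpha (haar_elt G) = haar_elt G ⊗ 1
}.

Record qAut (R : realType) (G : hopf_data R) := QAut {
  qAut_cqg :> cqg R ;
  qAut_act : G -> tens G qAut_cqg ;
  qAut_family : quantum_family qAut_act ;
  qAut_universal : forall (B : cstarType R) (alpha : G -> tens G B),
    quantum_family alpha ->
    exists! L : qAut_cqg -> B,
      star_hom L /\ (forall x, alpha x = tmap idfun L (qAut_act x)) ;
  (* (id (x) Delta) \o alpha = (alpha (x) id) \o alpha *)
  qAut_action : forall x,
    tmap idfun (@cqg_coprod R qAut_cqg) (qAut_act x)
    = tlift (fun y b => tmap idfun
               (fun c => @leg1 R qAut_cqg c * @leg2 R qAut_cqg b) (qAut_act y))
            (qAut_act x)
}.

(* Main.v *)
From HB Require Import structures.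
Require Import Defs.
From mathcomp Require Import all_boot all_order all_algebra.
From mathcomp Require Import complex ring lra.
From mathcomp Require Import all_classical all_reals all_analysis.

(* Let F a = h(. a) be the Fourier transform from C(G) to its dual. It turns
   convolution into the product and convolution adjoint into the involution,
   and the Haar element into a multiple of the unit; conversely it turns the
   involution into convolution adjoint, the unit into the Haar element, and the
   product into a multiple of the opposite convolution. Since a quantum family
   alpha preserves both adjoints, it commutes with the antipode S, which is
   antimultiplicative; so F o S can replace F to repair the order of the
   factors. Hence alpha |-> (F (x) id) o alpha o F^-1 is a bijection from the
   quantum families of automorphisms of G to those of its dual, and the two
   universal families determine mutually inverse *-isomorphisms. These respect
   the coproducts because *-homomorphisms that agree on the universal action
   are equal. *)

Set Implicit Arguments.
Unset Strict Implicit.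
Unset Printing Implicit Defensive.
Import Order.TTheory GRing.Theory Num.Theory.
Local Open Scope classical_set_scope.
Local Open Scope ring_scope.

(** * Linear algebra of tensor products *)

Section Tensor.
Variable K : fieldType.
Implicit Types A : vectType K.
Implicit Types B : lmodType K.

(* Weaker than bilinearity, so that it also covers pairs of antilinear maps. *)
Definition balanced A B (V : zmodType) (f : A -> B -> V) : Prop :=
  [/\ forall b, {morph f^~ b : a a' / a + a'},
      forall a, {morph f a : b b' / b + b'}
    & forall c a b, f (c *: a) b = f a (c *: b)].

Definition bilin (A B V : lmodType K) (f : A -> B -> V) : Prop :=
  (forall b, linear (f^~ b)) /\ (forall a, linear (f a)).

Lemma linD (U V : lmodType K) (f : U -> V) : linear f -> {morph f : x y / x + y}.
Proof. by move=> lf x y; rewrite -[x]scale1r lf !scale1r. Qed.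

Lemma lin0 (U V : lmodType K) (f : U -> V) : linear f -> f 0 = 0.
Proof. by move=> lf; apply: (addrI (f 0)); rewrite -linD // !addr0. Qed.

Lemma linZ (U V : lmodType K) (f : U -> V) : linear f -> forall c, {morph f : x / c *: x}.
Proof. by move=> lf c x; rewrite -[c *: x]addr0 lf lin0 // addr0. Qed.

Lemma lin_comp (U V W : lmodType K) (f : V -> W) (g : U -> V) :
  linear f -> linear g -> linear (f \o g).
Proof. by move=> lf lg c x y /=; rewrite lg lf. Qed.

Lemma bilin_balanced A B (V : lmodType K) (f : A -> B -> V) :
  bilin f -> balanced f.
Proof.
move=> [l1 l2]; split=> [b|a|c a b]; try exact: linD.
by rewrite (linZ (l1 b)) (linZ (l2 a)).
Qed.

Lemma tpureDl A B (a a' : A) (b : B) : (a + a') ⊗ b = a ⊗ b + a' ⊗ b.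
Proof. by apply/ffunP=> i; rewrite !ffunE linearD scalerDl. Qed.

Lemma tpureDr A B (a : A) (b b' : B) : a ⊗ (b + b') = a ⊗ b + a ⊗ b'.
Proof. by apply/ffunP=> i; rewrite !ffunE scalerDr. Qed.

Lemma tpureZl A B c (a : A) (b : B) : (c *: a) ⊗ b = c *: (a ⊗ b).
Proof. by apply/ffunP=> i; rewrite !ffunE linearZ scalerA. Qed.

Lemma tpureZr A B c (a : A) (b : B) : a ⊗ (c *: b) = c *: (a ⊗ b).
Proof. by apply/ffunP=> i; rewrite !ffunE !scalerA mulrC. Qed.

Lemma tens_sum A B (t : tens A B) : t = \sum_(i < _) ((vbasis fullv)`_i ⊗ t i).
Proof.
apply/ffunP=> j; rewrite sum_ffunE (bigD1 j) //= big1 ?addr0 => [|i ij].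
  by rewrite ffunE coord_free ?(basis_free (vbasisP _)) // eqxx scale1r.
by rewrite ffunE coord_free ?(basis_free (vbasisP _)) // (negbTE ij) scale0r.
Qed.

Lemma coord_vbasisT A (a : A) :
  a = \sum_(i < _) coord (vbasis fullv) i a *: (vbasis fullv)`_i.
Proof. by rewrite -coord_vbasis ?memvf. Qed.

Lemma eq_tlift A B (V : nmodType) (f g : A -> B -> V) t :
  (forall a b, f a b = g a b) -> tlift f t = tlift g t.
Proof. by move=> fg; apply: eq_bigr. Qed.

Lemma morph_sum (U V : zmodType) (f : U -> V) : {morph f : x y / x + y} ->
  forall I (r : seq I) (F : I -> U), f (\sum_(i <- r) F i) = \sum_(i <- r) f (F i).
Proof.
move=> fD I r F.
have f0 : f 0 = 0 by apply: (addrI (f 0)); rewrite -fD !addr0.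
by apply: (big_morph f fD f0).
Qed.

Lemma tlift_comp A B (U V : zmodType) (g : U -> V) (f : A -> B -> U) t :
  {morph g : x y / x + y} -> g (tlift f t) = tlift (fun a b => g (f a b)) t.
Proof. by move=> gD; rewrite /tlift morph_sum. Qed.

Lemma tliftE A B (U V : lmodType K) (g : U -> V) (f : A -> B -> U) t :
  linear g -> g (tlift f t) = tlift (fun a b => g (f a b)) t.
Proof. by move=> /linD; apply: tlift_comp. Qed.

Lemma tlift_pure A B (V : zmodType) (f : A -> B -> V) a b :
  balanced f -> tlift f (a ⊗ b) = f a b.
Proof.
move=> [fDl fDr fZ]; rewrite [in RHS](coord_vbasisT a) (morph_sum (fDl b)).
by apply: eq_bigr => i _; rewrite fZ ffunE.
Qed.

Lemma tliftD A B (V : zmodType) (f : A -> B -> V) :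
  balanced f -> {morph tlift f : t t' / t + t'}.
Proof.
move=> [_ fDr _] t t'; rewrite -big_split /=.
by apply: eq_bigr => i _; rewrite ffunE fDr.
Qed.

Lemma tlift_linear A B (V : lmodType K) (f : A -> B -> V) :
  (forall a, linear (f a)) -> linear (tlift f).
Proof.
move=> lf c t t'; rewrite /tlift scaler_sumr -big_split /=.
by apply: eq_bigr => i _; rewrite !ffunE lf.
Qed.

Lemma tlift_fun_linear A B (U V : lmodType K) (f : U -> A -> B -> V) t :
  (forall a b, linear (fun u => f u a b)) -> linear (fun u => tlift (f u) t).
Proof.
move=> lf c u v; rewrite /tlift scaler_sumr -big_split /=.
by apply: eq_bigr => i _; rewrite lf.
Qed.

Lemma tlift_tlift A B A' B' (V : zmodType) (f : A' -> B' -> V)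
    (g : A -> B -> tens A' B') t : balanced f ->
  tlift f (tlift g t) = tlift (fun a b => tlift f (g a b)) t.
Proof. by move=> bf; rewrite tlift_comp //; apply: tliftD. Qed.

Lemma tlift_tmap A B A' B' (V : zmodType) (f : A' -> B' -> V)
    (g : A -> A') (h : B -> B') t : balanced f ->
  tlift f (tmap g h t) = tlift (fun a b => f (g a) (h b)) t.
Proof.
move=> bf; rewrite tlift_tlift //; apply: eq_tlift => a b.
by rewrite tlift_pure.
Qed.

Lemma tlift_exchange A B A' B' (V : nmodType) (f : A -> B -> A' -> B' -> V) t t' :
  tlift (fun a b => tlift (f a b) t') t
  = tlift (fun a' b' => tlift (fun a b => f a b a' b') t) t'.
Proof. exact: exchange_big. Qed.

Lemma tmap_comp A B A' B' A'' B'' (f : A' -> A'') (f' : A -> A')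
    (g : B' -> B'') (g' : B -> B') t :
  balanced (fun a b => f a ⊗ g b) ->
  tmap f g (tmap f' g' t) = tmap (f \o f') (g \o g') t.
Proof. exact: tlift_tmap. Qed.

Lemma tmap_id A B (t : tens A B) : tmap idfun idfun t = t.
Proof. by rewrite [RHS]tens_sum. Qed.

Lemma eq_tmap A B A' B' (f f' : A -> A') (g g' : B -> B') t :
  f =1 f' -> g =1 g' -> tmap f g t = tmap f' g' t.
Proof. by move=> ff gg; apply: eq_tlift => a b; rewrite ff gg. Qed.

Lemma tmap_balanced A B A' B' (f : A -> A') (g : B -> B') :
  linear f -> linear g -> balanced (fun a b => f a ⊗ g b).
Proof.
move=> lf lg; apply: bilin_balanced; split=> [b|a] c x y.
  by rewrite lf tpureDl tpureZl.
by rewrite lg tpureDr tpureZr.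
Qed.

Lemma tmap_linear A B A' B' (f : A -> A') (g : B -> B') :
  linear g -> linear (tmap f g).
Proof.
by move=> lg; apply: tlift_linear => a c x y; rewrite lg tpureDr tpureZr.
Qed.

Lemma linfunE (U V : vectType K) (f : U -> V) : linear f -> linfun f =1 f.
Proof.
by move=> lf x; pose g : {linear U -> V} := HB.pack f (GRing.isLinear.Build _ _ _ _ f lf);
  rewrite -[f]/(g : U -> V) lfunE.
Qed.

Lemma tmul_bilin A B (mA : A -> A -> A) (mB : B -> B -> B) a b :
  bilin mA -> bilin mB -> bilin (fun a' b' => mA a a' ⊗ mB b b').
Proof.
move=> [_ rA] [_ rB]; split=> [b'|a'] c x y.
  by rewrite rA tpureDl tpureZl.
by rewrite rB tpureDr tpureZr.
Qed.

Lemma tmul_bilin2 A B (mA : A -> A -> A) (mB : B -> B -> B) t' :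
  bilin mA -> bilin mB ->
  bilin (fun a b => tlift (fun a' b' => mA a a' ⊗ mB b b') t').
Proof.
move=> [lA _] [lB _]; split=> [b|a].
  by apply: tlift_fun_linear => a' b' c x y; rewrite lA tpureDl tpureZl.
by apply: tlift_fun_linear => a' b' c x y; rewrite lB tpureDr tpureZr.
Qed.

Lemma tmul_tmap A B A' B' (mA : A' -> A' -> A') (mB : B' -> B' -> B')
    (f f' : A -> A') (g g' : B -> B') t t' : bilin mA -> bilin mB ->
  tmul mA mB (tmap f g t) (tmap f' g' t')
  = tlift (fun a b => tlift (fun a' b' => mA (f a) (f' a') ⊗ mB (g b) (g' b')) t') t.
Proof.
move=> bA bB; rewrite /tmul tlift_tmap; last exact/bilin_balanced/tmul_bilin2.
by apply: eq_tlift => a b; rewrite tlift_tmap //; apply/bilin_balanced/tmul_bilin.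
Qed.

Lemma tmap_tmul A B A' B' (mA : A -> A -> A) (mB : B -> B -> B)
    (f : A -> A') (g : B -> B') t t' : linear f -> linear g ->
  tmap f g (tmul mA mB t t')
  = tlift (fun a b => tlift (fun a' b' => f (mA a a') ⊗ g (mB b b')) t') t.
Proof.
move=> lf lg; have bfg := tmap_balanced lf lg.
rewrite /tmap tlift_tlift //; apply: eq_tlift => a b.
by rewrite tlift_tlift //; apply: eq_tlift => a' b'; rewrite tlift_pure.
Qed.

End Tensor.

(** * C*-norms and extension of homomorphisms *)

Section CStarNorm.
Variables (R : realType) (A : cstarType R).
Implicit Types (x y z : A) (c : R[i]).

Lemma cnormZ_real c : exists2 r : R, 0 <= r & forall x, cnorm (c *: x) = r * cnorm x.
Proof.
have [r r0 cr] : exists2 r : R, 0 <= r & `|c| = r%:C%C.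
  exists (complex.Re `|c|); last by rewrite RRe_real // normr_real.
  by have := normr_ge0 c; rewrite lecE /= => /andP[_].
by exists r => // x; apply: (@complexI R); rewrite cnormZ cr rmorphM.
Qed.

Lemma cnorm0 : cnorm (0 : A) = 0.
Proof. by have := cnormZ 0 (0 : A); rewrite scale0r normr0 mul0r => /complexI. Qed.

Lemma cnormN x : cnorm (- x) = cnorm x.
Proof. by apply: (@complexI R); rewrite -scaleN1r cnormZ normrN1 mul1r. Qed.

Lemma cnorm_ge0 x : 0 <= cnorm x.
Proof. by have := ler_cnormD x (- x); rewrite subrr cnorm0 cnormN; lra. Qed.

Lemma cnormB x y : cnorm (x - y) = cnorm (y - x).
Proof. by rewrite -cnormN opprB. Qed.

Lemma cnorm_triangle y x z : cnorm (x - z) <= cnorm (x - y) + cnorm (y - z).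
Proof. by rewrite -{1}(subrK y x) -addrA ler_cnormD. Qed.

Lemma adjD : {morph (@adj R A) : x y / x + y}.
Proof. by move=> x y; rewrite -[x]scale1r adj_antilinear rmorph1 !scale1r. Qed.

Lemma adj0 : adj (0 : A) = 0.
Proof. by apply: (addrI (adj (0 : A))); rewrite -adjD !addr0. Qed.

Lemma adjZ c x : adj (c *: x) = c^* *: adj x.
Proof. by rewrite -[c *: x]addr0 adj_antilinear adj0 addr0. Qed.

Lemma adjB x y : adj (x - y) = adj x - adj y.
Proof. by rewrite adjD -scaleN1r adjZ rmorphN1 scaleN1r. Qed.

(** The C*-identity and submultiplicativity bound the square of the norm of y by the product of the
    norms of [adj y] and y, so y is at most [adj y] in norm. Taking [adj x] for y gives the
    converse. *)
Lemma cnorm_adj x : cnorm (adj x) = cnorm x.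
Proof.
suff le y : cnorm y <= cnorm (adj y) by apply: le_anti; rewrite le -{2}(adjK x) le.
have := ler_cnormM (adj y) y; rewrite cnorm_adjM.
have := cnorm_ge0 y; have := cnorm_ge0 (adj y).
rewrite le_eqVlt => /predU1P[<-|]; first by rewrite mul0r; nra.
by move=> a0; rewrite le_eqVlt => /predU1P[<-|y0]; [lra | rewrite expr2 ler_pM2r].
Qed.

Lemma cnorm_eq0_lt x : (forall e : R, 0 < e -> cnorm x < e) -> x = 0.
Proof.
move=> xe; apply: cnorm0_eq0; apply/eqP; rewrite eq_le cnorm_ge0 andbT.
by rewrite leNgt; apply/negP => /xe; rewrite ltxx.
Qed.

End CStarNorm.

(** * Extension by continuity of a densely defined contractive homomorphism *)

Section Extension.
Variables (R : realType) (T T' : cstarType R) (P : T -> T' -> Prop).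
Hypothesis P1 : P 1 1.
Hypothesis Plin : forall c s s' t t', P s s' -> P t t' -> P (c *: s + t) (c *: s' + t').
Hypothesis PM : forall s s' t t', P s s' -> P t t' -> P (s * t) (s' * t').
Hypothesis Padj : forall s s', P s s' -> P (adj s) (adj s').
Hypothesis Pcontr : forall s s', P s s' -> cnorm s' <= cnorm s.
Hypothesis Pdense : cstar_dense [set s | exists s', P s s'].

(** [P] stands for the graph of a contractive homomorphism on a dense subalgebra, and [rel] for the
    closure of that graph. With a relation, well-definedness follows from [Pcontr] applied to
    differences. *)
Let rel x y := forall e : R, 0 < e ->
  exists s s', [/\ P s s', cnorm (x - s) < e & cnorm (y - s') < e].

Let PB s s' t t' : P s s' -> P t t' -> P (s - t) (s' - t').
Proof.
by move=> ss tt; have := Plin (-1) tt ss; rewrite !scaleN1r ![- _ + _]addrC.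
Qed.

Let rel_P s s' : P s s' -> rel s s'.
Proof. by move=> ss e e0; exists s, s'; rewrite !subrr !cnorm0. Qed.

Let rel_inj x y y' : rel x y -> rel x y' -> y = y'.
Proof.
move=> xy xy'; apply/eqP; rewrite -subr_eq0; apply/eqP/cnorm_eq0_lt => e e0.
have e4 : 0 < e / 4%:R by rewrite divr_gt0.
have [s [s' [ss xs ys]]] := xy _ e4; have [t [t' [tt xt yt]]] := xy' _ e4.
have := Pcontr (PB ss tt); have := cnorm_triangle x s t.
have := cnorm_triangle s' y y'; have := cnorm_triangle t' s' y'.
by rewrite (cnormB s x) (cnormB t' y'); lra.
Qed.

Let rel_total x : exists y, rel x y.
Proof.
(* A sequence in the domain of [P] converging to x; by contractivity its images are Cauchy, and
   their limit is the partner of x. *)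
have /choice[s sP] (n : nat) :
    exists s, (exists s', P s s') /\ cnorm (x - s) < n.+1%:R^-1.
  have n0 : 0 < n.+1%:R^-1 :> R by rewrite invr_gt0 ltr0n.
  have [s ss xs] := Pdense x n0.
  by exists s.
have /choice[s' s'P] (n : nat) := (sP n).1.
have inve (e : R) : 0 < e -> exists N : nat, forall n, (N <= n)%N -> cnorm (x - s n) < e.
  move=> e0; exists (Num.bound e^-1) => n Nn; apply: lt_trans (sP n).2 _.
  rewrite invf_plt ?posrE ?ltr0n //;
  apply: lt_le_trans (archi_boundP _) _; first by rewrite invr_ge0 ltW.
  by rewrite ler_nat leqW.
have [|y yP] := @cnorm_complete _ _ s'.
  move=> e e0; have [|N Ne] := inve (e / 2%:R); first by rewrite divr_gt0.
  exists N => m n Nm Nn; have := Pcontr (PB (s'P m) (s'P n)).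
  by have := Ne m Nm; have := Ne n Nn; have := cnorm_triangle x (s m) (s n);
    rewrite (cnormB (s m) x); lra.
exists y => e e0; have [N Ne] := inve e e0; have [M Me] := yP e e0.
exists (s (maxn N M)), (s' (maxn N M)); split=> //; first by apply: Ne; rewrite leq_maxl.
by rewrite cnormB; apply: Me; rewrite leq_maxr.
Qed.

Let rel_lin c x x' y y' : rel x x' -> rel y y' -> rel (c *: x + y) (c *: x' + y').
Proof.
move=> xx yy e e0.
have [r r0 cr] := cnormZ_real T c; have [r' r'0 cr'] := cnormZ_real T' c.
(* [k] dominates the factors by which c scales the two norms; the summand 1 keeps it positive when c
   = 0. *)
pose k : R := 1 + r + r'; have k0 : 0 < k by rewrite /k; lra.
have [|s [s' [ss xs xs']]] := xx (e / (k *+ 2)); first by rewrite divr_gt0 // pmulrn_lgt0.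
have [|t [t' [tt yt yt']]] := yy (e / 2%:R); first by rewrite divr_gt0.
have aux (U : cstarType R) (q : R) (u v u1 v1 : U) :
    (forall w : U, cnorm (c *: w) = q * cnorm w) ->
    0 <= q -> q <= k -> cnorm (u - u1) < e / (k *+ 2) -> cnorm (v - v1) < e / 2%:R ->
    cnorm (c *: u + v - (c *: u1 + v1)) < e.
  move=> cq q0 qk uu vv; rewrite opprD addrACA -scalerBr.
  apply: le_lt_trans (ler_cnormD _ _) _; rewrite cq.
  rewrite [ltRHS](_ : e = e / 2%:R + e / 2%:R); last by field.
  rewrite ler_ltD //; apply: le_trans (_ : k * (e / (k *+ 2)) <= _).
    by rewrite ler_pM ?cnorm_ge0 // ltW.
  by rewrite le_eqVlt; apply/orP; left; apply/eqP; field; lra.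
exists (c *: s + t), (c *: s' + t'); split; first exact: Plin.
  by apply: aux cr _ _ xs yt => //; rewrite /k; lra.
by apply: aux cr' _ _ xs' yt' => //; rewrite /k; lra.
Qed.

Let rel_mul x x' y y' : rel x x' -> rel y y' -> rel (x * y) (x' * y').
Proof.
move=> xx yy e e0.
(* In uv - u1 v1 = u (v - v1) + (u - u1) v1 both cofactors have norm at most [k]: the summand 1 and
   d <= 1 take care of the approximant v1. The error is at most 2dk, which 3dk <= e makes strictly
   less than e. *)
pose k : R := 1 + cnorm x + cnorm y + cnorm x' + cnorm y'.
have := cnorm_ge0 x; have := cnorm_ge0 y; have := cnorm_ge0 x'; have := cnorm_ge0 y'.
move=> y'0 x'0 y0 x0.
have k0 : 0 < k by rewrite /k; lra.
pose d := Num.min 1 (e / (k *+ 3)).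
have d0 : 0 < d by rewrite lt_min ltr01 divr_gt0 // pmulrn_lgt0.
have d1 : d <= 1 by rewrite ge_min lexx.
have kd : d * k *+ 3 <= e.
  by rewrite -mulrnAr -ler_pdivlMr ?pmulrn_lgt0 // ge_min lexx orbT.
have [s [s' [ss xs xs']]] := xx d d0; have [t [t' [tt yt yt']]] := yy d d0.
have aux (U : cstarType R) (u v u1 v1 : U) : 1 + cnorm u + cnorm v <= k ->
    cnorm (u - u1) < d -> cnorm (v - v1) < d -> cnorm (u * v - u1 * v1) < e.
  move=> uvk uu vv.
  have -> : u * v - u1 * v1 = u * (v - v1) + (u - u1) * v1.
    by rewrite mulrBr mulrBl addrA subrK.
  apply: le_lt_trans (ler_cnormD _ _) _.
  apply: le_lt_trans (lerD (ler_cnormM _ _) (ler_cnormM _ _)) _.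
  have v1k : cnorm v1 <= k.
    by have := ler_cnormD (v1 - v) v; rewrite subrK cnormB; have := cnorm_ge0 u; lra.
  have uk : cnorm u <= k by have := cnorm_ge0 v; lra.
  apply: le_lt_trans (lerD (ler_pM _ _ uk (ltW vv)) (ler_pM _ _ (ltW uu) v1k)) _;
    rewrite ?cnorm_ge0 //.
  have dk : 0 < d * k by rewrite mulr_gt0.
  by rewrite [k * d]mulrC; lra.
exists (s * t), (s' * t'); split; first exact: PM.
  by apply: aux xs yt; rewrite /k; lra.
by apply: aux xs' yt'; rewrite /k; lra.
Qed.

Let rel_adj x x' : rel x x' -> rel (adj x) (adj x').
Proof.
move=> xx e e0; have [s [s' [ss xs xs']]] := xx e e0.
by exists (adj s), (adj s'); rewrite -!adjB !cnorm_adj; split=> //; exact: Padj.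
Qed.

Lemma star_hom_extension :
  exists F : T -> T', star_hom F /\ forall s s', P s s' -> F s = s'.
Proof.
have [F FP] := choice rel_total.
have Frel x y : rel x y -> F x = y by exact: rel_inj.
exists F; split=> [|s s' ss]; last exact/Frel/rel_P.
split=> [c x y||x]; first exact/Frel/rel_lin.
  by split=> [|x y]; apply/Frel; [exact: rel_P | exact: rel_mul].
exact/Frel/rel_adj.
Qed.

End Extension.

(** * Homomorphisms of C*-algebras and their spatial tensor products *)

Section StarHom.
Variable R : realType.
Implicit Types A B C : cstarType R.

Lemma star_hom_linear A B (f : A -> B) : star_hom f -> linear f.
Proof. by case. Qed.

Lemma star_hom1 A B (f : A -> B) : star_hom f -> f 1 = 1.
Proof. by case=> _ []. Qed.

Lemma star_homM A B (f : A -> B) : star_hom f -> {morph f : x y / x * y}.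
Proof. by case=> _ []. Qed.

Lemma star_hom_adj A B (f : A -> B) : star_hom f -> {morph f : x / adj x}.
Proof. by case. Qed.

Lemma star_hom_id A : star_hom (@idfun A).
Proof. by []. Qed.

Lemma star_hom_comp A B C (f : B -> C) (g : A -> B) :
  star_hom f -> star_hom g -> star_hom (f \o g).
Proof.
move=> [lf [f1 fM] fa] [lg [g1 gM] ga]; split=> [||x] /=; last by rewrite ga fa.
  exact: lin_comp.
by split=> [|x y] /=; [rewrite g1 | rewrite gM fM].
Qed.

Lemma cstar_rep_comp A B (f : A -> B) (H : hilbert R) (pi : B -> H -> H) :
  star_hom f -> cstar_rep pi -> cstar_rep (pi \o f).
Proof.
move=> [lf [f1 fM] fa] [l1 l2 p1 pM pa]; split=> [a|x c a b|x|a b x|a x y] /=.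
- exact: l1.
- by rewrite lf; apply: l2.
- by rewrite f1.
- by rewrite fM.
- by rewrite pa fa.
Qed.

Lemma adj_sum A I (r : seq I) (F : I -> A) :
  adj (\sum_(k <- r) F k) = \sum_(k <- r) adj (F k).
Proof. by rewrite (morph_sum (@adjD R A)). Qed.

(** On finite sums of elementary tensors f ⊗ g is contractive, since representations of A' and B'
    pulled back along f and g are among those that define the norm on T. It therefore extends by
    continuity. *)
Lemma tensor_hom_exists A B A' B' (T T' : cstarType R)
    (i : A -> T) (j : B -> T) (i' : A' -> T') (j' : B' -> T')
    (f : A -> A') (g : B -> B') :
  spatial_tensor i j -> spatial_tensor i' j' -> star_hom f -> star_hom g ->
  exists F, tensor_hom i j (i' \o f) (j' \o g) F.
Proof.
move=> [hi hj ij dij nij] [hi' hj' ij' _ nij'] hf hg.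
pose P s s' := exists r : seq (A * B),
  s = \sum_(p <- r) i p.1 * j p.2 /\ s' = \sum_(p <- r) i' (f p.1) * j' (g p.2).
have [|||||| F [hF FP]] := @star_hom_extension R T T' P.
- exists [:: (1, 1)]; rewrite !big_seq1 /=.
  by rewrite !(star_hom1 hf, star_hom1 hg, star_hom1 hi, star_hom1 hj,
    star_hom1 hi', star_hom1 hj') !mulr1.
- move=> c s s' t t' [r [-> ->]] [r' [-> ->]].
  exists ([seq (c *: p.1, p.2) | p <- r] ++ r').
  rewrite !big_cat !big_map /= !scaler_sumr; split; congr (_ + _).
    by apply: eq_bigr => p _; rewrite (linZ (star_hom_linear hi)) scalerAl.
  apply: eq_bigr => p _.
  by rewrite (linZ (star_hom_linear hf)) (linZ (star_hom_linear hi')) scalerAl.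
- move=> s s' t t' [r [-> ->]] [r' [-> ->]].
  exists [seq (p.1 * q.1, p.2 * q.2) | p <- r, q <- r'].
  rewrite !big_allpairs_dep /= !mulr_suml; split; apply: eq_bigr => p _;
    rewrite mulr_sumr; apply: eq_bigr => q _.
    by rewrite (star_homM hi) (star_homM hj) !mulrA; congr (_ * _); rewrite -!mulrA ij.
  rewrite (star_homM hf) (star_homM hg) (star_homM hi') (star_homM hj').
  rewrite !mulrA; congr (_ * _).
  by rewrite -!mulrA ij'.
- move=> s s' [r [-> ->]]; exists [seq (adj p.1, adj p.2) | p <- r].
  rewrite !big_map !adj_sum; split; apply: eq_bigr => p _; rewrite adjM /=.
    by rewrite -(star_hom_adj hi) -(star_hom_adj hj) ij.
  by rewrite (star_hom_adj hf) (star_hom_adj hg) -(star_hom_adj hi') -(star_hom_adj hj') ij'.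
- move=> s s' [r [-> ->]]; rewrite !(big_tnth _ _ r).
  apply/(nij' _ _ _ _ (cnorm_ge0 _)) => H K pi rho hpi hrho.
  have /nij/(_ H K _ _ (cstar_rep_comp hf hpi) (cstar_rep_comp hg hrho)) :=
    lexx (cnorm (\sum_k i (tnth (in_tuple r) k).1 * j (tnth (in_tuple r) k).2)).
  by apply; apply: cnorm_ge0.
(* Scalars are absorbed into the left factors, so the lists in [P] reach the whole dense span. *)
- move=> x e /(dij x)[y [n [c [v [vP ->]]]] xy].
  exists (\sum_k c k *: v k) => //.
  have /choice[p pP] k : exists p : A * B, v k = i p.1 * j p.2.
    by have [a [b ->]] := vP k; exists (a, b).
  exists (\sum_(q <- [seq (c k *: (p k).1, (p k).2) | k <- index_enum 'I_n])
    i' (f q.1) * j' (g q.2)).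
  exists [seq (c k *: (p k).1, (p k).2) | k <- index_enum 'I_n]; split=> //.
  rewrite big_map; apply: eq_bigr => k _ /=.
  by rewrite (linZ (star_hom_linear hi)) -scalerAl pP.
exists F; split=> // [a|b]; apply: FP.
  exists [:: (a, 1)]; rewrite !big_seq1 /=.
  by rewrite (star_hom1 hj) (star_hom1 hg) (star_hom1 hj') !mulr1.
exists [:: (1, b)]; rewrite !big_seq1 /=.
by rewrite (star_hom1 hi) (star_hom1 hf) (star_hom1 hi') !mul1r.
Qed.

End StarHom.

(** * Finite quantum groups *)

Section Hopf.
Variables (R : realType) (G : hopf_data R).
Hypothesis hG : finite_quantum_group G.
Local Notation C := R[i].
Local Notation D := (coprod G).
Local Notation S := (antipode G).
Implicit Types (a b c x y z : G).

Let h (x : G) : C := haar G x.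
Let eps (x : G) : C := counit G x.

(** The algebra laws come from [fqg_cstar]: here and in the next lemmas they are pulled back along
    the bijection f onto a C*-algebra. *)
Lemma hmul_bilin : bilin (@hmul R G).
Proof.
have [A [f [lf bf fM f1 fs]]] := fqg_cstar hG.
have fI := bij_inj bf.
by split=> [b c x y|b c x y]; apply: fI;
  rewrite !(fM, lf) (mulrDl, mulrDr) -?scalerAl -?scalerAr.
Qed.

Lemma hmulA : associative (@hmul R G).
Proof.
have [A [f [lf bf fM f1 fs]]] := fqg_cstar hG.
by move=> x y z; apply: (bij_inj bf); rewrite !fM mulrA.
Qed.

Lemma hmul1r : left_id hone (@hmul R G).
Proof.
have [A [f [lf bf fM f1 fs]]] := fqg_cstar hG.
by move=> x; apply: (bij_inj bf); rewrite !fM f1 mul1r.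
Qed.

Lemma hmulr1 : right_id hone (@hmul R G).
Proof.
have [A [f [lf bf fM f1 fs]]] := fqg_cstar hG.
by move=> x; apply: (bij_inj bf); rewrite !fM f1 mulr1.
Qed.

Lemma hstar_antilin (k : C) x y : hstar (k *: x + y) = k^* *: hstar x + hstar y.
Proof.
have [A [f [lf bf fM f1 fs]]] := fqg_cstar hG.
by apply: (bij_inj bf); rewrite !(fs, lf) adj_antilinear.
Qed.

Lemma hstarK : involutive (@hstar R G).
Proof.
have [A [f [lf bf fM f1 fs]]] := fqg_cstar hG.
by move=> x; apply: (bij_inj bf); rewrite !fs adjK.
Qed.

Lemma hstarM x y : hstar (hmul x y) = hmul (hstar y) (hstar x).
Proof.
have [A [f [lf bf fM f1 fs]]] := fqg_cstar hG.
by apply: (bij_inj bf); rewrite !(fs, fM) adjM.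
Qed.

Let mDl b : {morph (@hmul R G)^~ b : x y / x + y} := linD (hmul_bilin.1 b).
Let mDr b : {morph (@hmul R G) b : x y / x + y} := linD (hmul_bilin.2 b).
Let mZl b (k : C) : {morph (@hmul R G)^~ b : x / k *: x} := linZ (hmul_bilin.1 b) k.
Let mZr b (k : C) : {morph (@hmul R G) b : x / k *: x} := linZ (hmul_bilin.2 b) k.

Let hD : {morph h : x y / x + y}.
Proof. by move=> x y; rewrite /h linearD. Qed.
Let hZ (k : C) x : h (k *: x) = k * h x.
Proof. by rewrite /h linearZ. Qed.
Let epsZ (k : C) x : eps (k *: x) = k * eps x.
Proof. by rewrite /eps linearZ. Qed.

Let hC x y : h (hmul x y) = h (hmul y x). Proof. exact: fqg_haar_trace. Qed.
Let SK : involutive S. Proof. exact: fqg_antipodeK. Qed.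

Lemma coprod_hmul (V : zmodType) (f : G -> G -> V) x y : balanced f ->
  tlift f (D (hmul x y))
  = tlift (fun u1 u2 => tlift (fun v1 v2 => f (hmul u1 v1) (hmul u2 v2)) (D y)) (D x).
Proof.
move=> bf; rewrite fqg_coprodM // tlift_tlift //; apply: eq_tlift => u1 u2.
by rewrite tlift_tlift //; apply: eq_tlift => v1 v2; rewrite tlift_pure.
Qed.

Lemma coprod_coassoc (V : lmodType C) (f : G -> G -> G -> V) x :
  (forall b c, linear (fun a => f a b c)) -> (forall a c, linear (fun b => f a b c)) ->
  (forall a b, linear (f a b)) ->
  tlift (fun x1 x2 => tlift (fun y1 y2 => f y1 y2 x2) (D x1)) (D x)
  = tlift (fun x1 x2 => tlift (f x1) (D x2)) (D x).
Proof.
move=> l1 l2 l3; have bf a : balanced (f a) by apply: bilin_balanced; split.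
have bF : balanced (fun a => tlift (f a)).
  apply: bilin_balanced; split=> [t|a]; last exact: tlift_linear.
  by apply: tlift_fun_linear.
have := congr1 (tlift (fun a => tlift (f a))) (fqg_coassoc hG x).
rewrite tlift_tmap // tlift_tlift // => <-; apply: eq_tlift => x1 x2.
rewrite tlift_tlift //; apply: eq_tlift => y1 y2.
by rewrite !tlift_pure.
Qed.

(* Insert h(b_2 x) 1 = h(b_3 x_2) b_2 x_1, which is invariance of h, and cancel
   S(b_1) b_2. *)
Lemma strong_invariance b x :
  tlift (fun b1 b2 => h (hmul b2 x) *: S b1) (D b)
  = tlift (fun x1 x2 => h (hmul b x2) *: x1) (D x).
Proof.
transitivity (tlift (fun b1 b2 => tlift (fun u1 u2 => tlift (fun x1 x2 =>
    h (hmul u2 x2) *: hmul (S b1) (hmul u1 x1)) (D x)) (D b2)) (D b)).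
  apply: eq_tlift => b1 b2.
  rewrite -[S b1 in LHS]hmulr1 -mZr -(fqg_haarr hG) coprod_hmul; last first.
    apply: bilin_balanced; split=> [u|u] k v w.
      by rewrite scalerDr !scalerA mulrC.
    by rewrite linearD linearZ /= scalerDl scalerA.
  rewrite tliftE; last exact: hmul_bilin.2.
  apply: eq_tlift => u1 u2; rewrite tliftE; last exact: hmul_bilin.2.
  by apply: eq_tlift => x1 x2; rewrite mZr.
under eq_tlift do rewrite tlift_exchange.
rewrite tlift_exchange; apply: eq_tlift => x1 x2.
rewrite -(coprod_coassoc (f := fun b1 u1 u2 => h (hmul u2 x2) *:
  hmul (S b1) (hmul u1 x1))).
- transitivity (tlift (fun b1 b2 => eps b1 *: (h (hmul b2 x2) *: x1)) (D b)).
    apply: eq_tlift => b1 b2.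
    under eq_tlift do rewrite hmulA.
    rewrite -(tliftE (g := fun w => h (hmul b2 x2) *: hmul w x1)).
      by rewrite fqg_antipodel // mZl hmul1r !scalerA mulrC.
    by move=> k v w; rewrite mDl mZl scalerDr !scalerA mulrC.
  rewrite -[in RHS](fqg_counitl hG b).
  rewrite (tliftE (g := fun w => h (hmul w x2) *: x1)).
    by apply: eq_tlift => b1 b2; rewrite mZl hZ scalerA.
  by move=> k v w; rewrite mDl mZl hD hZ scalerDl scalerA.
- by move=> u v k w w'; rewrite linearP mDl mZl scalerDr !scalerA mulrC.
- by move=> u v k w w'; rewrite mDl mZl mDr mZr scalerDr !scalerA mulrC.
- by move=> u v k w w'; rewrite mDl mZl hD hZ scalerDl scalerA.
Qed.

(** * Bijectivity of the Fourier transform, integrals and the antipode *)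

Let fourier_lin a : linear (fun x : G => haar G (hmul x a)).
Proof. by move=> k x y; rewrite mDl mZl linearP. Qed.

Lemma fourierE a x : fourier G a x = haar G (hmul x a).
Proof.
rewrite linfunE; first exact/linfunE/fourier_lin.
move=> k b c; apply/lfunP => y; rewrite !lfunE /= !lfunE /= !linfunE //.
by rewrite mDr mZr linearP.
Qed.

Lemma fourier_inj : injective (fourier G).
Proof.
move=> a b ab; apply/eqP; rewrite -subr_eq0; apply/eqP/(fqg_haar_faithful hG).
by rewrite -fourierE linearB /= ab subrr lfunE.
Qed.

Lemma fourier_eq a b : (forall x, h (hmul x a) = h (hmul x b)) -> a = b.
Proof.
by move=> ab; apply: fourier_inj; apply/lfunP => x; rewrite !fourierE; apply: ab.
Qed.

Lemma fourierK : cancel (fourier G) (fourier G)^-1%VF.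
Proof. exact/lker0_lfunK/lker0P/fourier_inj. Qed.

(** F is injective because h is faithful, and G and its dual have the same dimension, so the image
    is everything. *)
Lemma fourierVK : cancel (fourier G)^-1%VF (fourier G).
Proof.
move=> w; apply: limg_lfunVK.
suff /eqP-> : limg (fourier G) == fullv by apply: memvf.
rewrite eqEdim subvf /= limg_dim_eq; first by rewrite !dimvf /dim /= muln1.
by have /lker0P/eqP-> := fourier_inj; rewrite capv0.
Qed.

(** This z is the preimage of the counit under F, a Haar element up to normalization. Absorption is
    traciality: h(xza) = h(axz) = eps(ax). If eps(z) vanished, so would h([hstar z] z), which is
    eps([hstar z]); faithfulness would then give z = 0, against eps(1) = 1. *)
Lemma haar_represents_counit : exists z, [/\ forall x, h (hmul x z) = eps x,
  forall a, hmul z a = eps a *: z & eps z != 0].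
Proof.
have [z zP] : exists z, forall x, h (hmul x z) = eps x.
  by exists ((fourier G)^-1%VF (counit G)) => x; rewrite /h -fourierE fourierVK.
exists z; split=> // [a|].
  apply: fourier_eq => x; rewrite mZr hZ zP hmulA hC hmulA zP.
  exact: fqg_counitM.
apply/eqP => z0; have : h (hmul (hstar z) z) = 0.
  by rewrite zP /eps fqg_counit_star // -/(eps z) z0 rmorph0.
move/(fqg_haar_faithful hG) => zz; have := zP hone.
rewrite zz (lin0 (hmul_bilin.2 _)) /h linear0 /eps fqg_counit1 // => /eqP.
by rewrite eq_sym oner_eq0.
Qed.

(** [strong_invariance] at x = z, where h(b_2 z) = eps(b_2) collapses the left side to S(b). It
    expresses S through the coproduct of z. *)
Lemma antipodeE z b : (forall x, h (hmul x z) = eps x) ->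
  S b = tlift (fun z1 z2 => h (hmul b z2) *: z1) (D z).
Proof.
move=> zP; rewrite -strong_invariance -{1}(fqg_counitr hG b).
rewrite (tliftE _ _ (g := S)); last exact: linearP.
by apply: eq_tlift => b1 b2; rewrite zP linearZ.
Qed.

(** Apply h to [antipodeE]: invariance turns h(z_1) z_2 into h(z) 1, and h(z) = eps(1) = 1. *)
Lemma haar_antipode x : haar G (S x) = haar G x.
Proof.
have [z [zP _ _]] := haar_represents_counit.
rewrite (antipodeE _ zP) (tliftE (g := haar G)); last exact: linearP.
transitivity (h (hmul x (tlift (fun z1 z2 => h z1 *: z2) (D z)))).
  rewrite (tliftE _ _ (g := fun w => h (hmul x w))); last first.
    by move=> k v w; rewrite mDr mZr hD hZ.
  by apply: eq_tlift => z1 z2; rewrite linearZ mZr hZ mulrC.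
rewrite fqg_haarl // mZr hmulr1 hZ -/(h z) -[z](hmul1r) zP.
by rewrite /eps fqg_counit1 // mul1r.
Qed.

(* Expand x = eps(x_1) x_2 on the left and use Delta(z) Delta(x_1) =
   eps(x_1) Delta(z) and x_2 S(x_3) = eps(x_2) 1. *)
Lemma integral_antipode (V : lmodType C) (f : G -> G -> V) z x : bilin f ->
  (forall a, hmul z a = eps a *: z) ->
  tlift (fun z1 z2 => f z1 (hmul z2 (S x))) (D z)
  = tlift (fun z1 z2 => f (hmul z1 x) z2) (D z).
Proof.
move=> bf za; have [lf rf] := bf.
have l1 u2 u3 : linear (fun u => tlift (fun z1 z2 =>
    f (hmul z1 u) (hmul (hmul z2 u2) (S u3))) (D z)).
  by apply: tlift_fun_linear => a b k v w; rewrite mDr mZr lf.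
have l2 u1 u3 : linear (fun u => tlift (fun z1 z2 =>
    f (hmul z1 u1) (hmul (hmul z2 u) (S u3))) (D z)).
  by apply: tlift_fun_linear => a b k v w; rewrite mDr mZr mDl mZl rf.
have l3 u1 u2 : linear (fun u => tlift (fun z1 z2 =>
    f (hmul z1 u1) (hmul (hmul z2 u2) (S u))) (D z)).
  by apply: tlift_fun_linear => a b k v w; rewrite linearP mDr mZr rf.
have l4 : linear (fun u => tlift (fun z1 z2 => f z1 (hmul z2 (S u))) (D z)).
  by apply: tlift_fun_linear => a b k v w; rewrite linearP mDr mZr rf.
have l5 : linear (fun u => tlift (fun z1 z2 => f (hmul z1 u) z2) (D z)).
  by apply: tlift_fun_linear => a b k v w; rewrite mDr mZr lf.
transitivity (tlift (fun x1 x2 => tlift (fun u1 u2 => tlift (fun z1 z2 =>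
    f (hmul z1 u1) (hmul (hmul z2 u2) (S x2))) (D z)) (D x1)) (D x)).
  rewrite -[in LHS](fqg_counitl hG x) (tliftE _ _ l4); apply: eq_tlift => x1 x2.
  transitivity (tlift (fun w1 w2 => f w1 (hmul w2 (S x2))) (D (hmul z x1))).
    rewrite za [D (_ *: z)]linearZ (linZ l4) (linZ (tlift_linear _)) // => a k v w.
    by rewrite mDl mZl rf.
  rewrite coprod_hmul; first by rewrite tlift_exchange.
  by apply: bilin_balanced; split=> a k v w; rewrite ?(mDl, mZl) (lf, rf).
rewrite (coprod_coassoc _ l1 l2 l3).
transitivity (tlift (fun x1 x2 =>
    eps x2 *: tlift (fun z1 z2 => f (hmul z1 x1) z2) (D z)) (D x)).
  apply: eq_tlift => x1 x2; rewrite tlift_exchange.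
  have lk : linear (fun w : V => eps x2 *: w).
    by move=> k v w; rewrite scalerDr !scalerA mulrC.
  rewrite (tliftE _ _ lk); apply: eq_tlift => z1 z2.
  under eq_tlift do rewrite -hmulA.
  rewrite -(tliftE (g := fun w => f (hmul z1 x1) (hmul z2 w))).
    by rewrite fqg_antipoder // mZr hmulr1 (linZ (rf _)).
  by move=> k v w; rewrite mDr mZr rf.
rewrite -[in RHS](fqg_counitr hG x) (tliftE _ _ l5).
by apply: eq_tlift => x1 x2; rewrite (linZ l5).
Qed.

(** By [antipodeE] the right side is the sum of h(y z_2) z_1 S(x). [integral_antipode] and S^2 = id
    turn it into the sum of h(y z_2 x) z_1, and traciality into that of h(xy z_2) z_1, which is
    S(xy). *)
Lemma antipode_hmul x y : S (hmul x y) = hmul (S y) (S x).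
Proof.
have [z [zP za _]] := haar_represents_counit.
have SE b := antipodeE b zP.
rewrite [S y]SE (tliftE _ _ (g := fun w => hmul w (S x))); last first.
  by move=> k v w; rewrite mDl mZl.
under [RHS]eq_tlift do rewrite mZl.
rewrite -(integral_antipode (f := fun a b => h (hmul y b) *: a)) //.
  by rewrite SE SK; apply: eq_tlift => z1 z2; rewrite hmulA -hmulA hC -hmulA.
split=> [b|a] k v w; last by rewrite mDr mZr hD hZ scalerDl scalerA.
by rewrite scalerDr !scalerA mulrC.
Qed.

Lemma haar_antipode_mul x y : h (hmul (S x) y) = h (hmul x (S y)).
Proof. by rewrite -[RHS]haar_antipode antipode_hmul SK; apply: hC. Qed.

Lemma haar_eltP :
  counit G (haar_elt G) = 1 /\ forall a, hmul a (haar_elt G) = eps a *: haar_elt G.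
Proof.
rewrite /haar_elt; have [z [zP _ z0]] := haar_represents_counit.
(* The element z / eps(z) satisfies the description, which rules out the default value 0 of
   [xget]. *)
case: xgetP => [e -> //|] /(_ ((eps z)^-1 *: z)) []; split.
  by rewrite -/(eps _) epsZ mulVf.
move=> a; apply: fourier_eq => x; rewrite !mZr !hZ hmulA !zP.
by rewrite /eps fqg_counitM // -!/(eps _); ring.
Qed.

(** For the Haar element e, h([hstar e] e) is a multiple of h(e), so h(e) = 0 would force e = 0,
    against eps(e) = 1. This makes the constants of the Fourier transform invertible. *)
Lemma haar_haar_elt_neq0 : h (haar_elt G) != 0.
Proof.
have [e1 ae] := haar_eltP; apply/eqP => h0.
have /(fqg_haar_faithful hG) e0 : h (hmul (hstar (haar_elt G)) (haar_elt G)) = 0.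
  by rewrite ae hZ h0 mulr0.
by move/eqP: e1; rewrite e0 linear0 eq_sym oner_eq0.
Qed.

Lemma hstar1 : hstar (hone : G) = hone.
Proof. by rewrite -[LHS]hmul1r -{1}[hone]hstarK -hstarM hmul1r hstarK. Qed.

End Hopf.

(** * The Fourier transform *)

Definition antilin (R : realType) (U V : lmodType R[i]) (f : U -> V) : Prop :=
  forall (k : R[i]) x y, f (k *: x + y) = k^* *: f x + f y.

(** The laws used when transporting quantum families; both G and its dual are shown to satisfy them,
    so that the transport works in either direction. *)
Record star_data (R : realType) (G : hopf_data R) : Prop := {
  sd_mul : bilin (@hmul R G) ;
  sd_mulr1 : right_id hone (@hmul R G) ;
  sd_star : antilin (@hstar R G) ;
  sd_starK : involutive (@hstar R G)
}.

Section Dual.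
Variables (R : realType) (G : hopf_data R).
Hypothesis hG : finite_quantum_group G.
Local Notation C := R[i].
Local Notation D := (coprod G).
Local Notation S := (antipode G).
Local Notation F := (fourier G).
Implicit Types (a b c x y z : G) (v w : dual G).

Let h (x : G) : C := haar G x.
Let eps (x : G) : C := counit G x.
Let mDl b : {morph (@hmul R G)^~ b : x y / x + y} := linD ((hmul_bilin hG).1 b).
Let mDr b : {morph (@hmul R G) b : x y / x + y} := linD ((hmul_bilin hG).2 b).
Let mZl b (k : C) : {morph (@hmul R G)^~ b : x / k *: x} := linZ ((hmul_bilin hG).1 b) k.
Let mZr b (k : C) : {morph (@hmul R G) b : x / k *: x} := linZ ((hmul_bilin hG).2 b) k.
Let hD : {morph h : x y / x + y}.
Proof. by move=> x y; rewrite /h linearD. Qed.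
Let hZ (k : C) x : h (k *: x) = k * h x.
Proof. by rewrite /h linearZ. Qed.
Let hC x y : h (hmul x y) = h (hmul y x). Proof. exact: fqg_haar_trace. Qed.
Let SK : involutive S. Proof. exact: fqg_antipodeK. Qed.
Let FE a x : F a x = h (hmul x a). Proof. exact: fourierE. Qed.
Let conjK : involutive (@Num.conj C). Proof. exact: conjCK. Qed.

Lemma finite_star_data : star_data G.
Proof.
split; [exact: hmul_bilin | exact: hmulr1 | exact: hstar_antilin | exact: hstarK].
Qed.

(* Polarization: h(y^* y) is real for y = x, x + 1 and x + i. *)
Lemma haar_star x : h (hstar x) = (h x)^*.
Proof.
have hreal y : (h (hmul (hstar y) y))^* = h (hmul (hstar y) y).
  exact/CrealP/ger0_real/(fqg_haar_ge0 hG).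
have sD y z : hstar (y + z) = hstar y + hstar z.
  by rewrite -[y]scale1r hstar_antilin // rmorph1 !scale1r.
have s1 := hstar1 hG.
have si : hstar ('i%C *: hone : G) = - 'i%C *: hone.
  have s0 : hstar (0 : G) = 0 by apply: (addrI (hstar (0 : G))); rewrite -sD !addr0.
  rewrite -['i%C *: hone]addr0 hstar_antilin // s1 s0 addr0; congr (_ *: _).
  by apply/eqP; rewrite eq_complex /= !oppr0 !eqxx.
have := hreal (x + hone); have := hreal (x + 'i%C *: hone); have := hreal x.
rewrite !sD s1 si !mDl !mDr !mZl !mZr !hmul1r // !hmulr1 // !hD !hZ.
have h1 : h hone = 1 by rewrite /h fqg_haar1.
have ci : ('i%C : C)^* = - 'i%C by apply/eqP; rewrite eq_complex /= !oppr0 !eqxx.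
rewrite h1 !rmorphD !rmorphM !rmorphN /= !rmorph1 ci => -> E1 E2.
set u := h (hstar x) in E1 E2 *; set v := h x in E1 E2 *; set t := h (hmul _ _) in E1 E2.
have i2 : 'i%C * 'i%C = -1 :> C by rewrite -expr2 sqr_i.
move: E1 E2 i2; move: u^* v^* t; move: 'i%C => i cu cv t E1 E2 i2.
move/(congr1 (fun q : C => q - (t + u + (v + 1)))): E2; rewrite subrr => E2.
move/(congr1 (fun q : C => i * (q - (t + i * u + (- i * v + - i * (i * 1)))))): E1.
rewrite subrr mulr0 => E1; move/(congr1 (fun q : C => q + 1)): i2; rewrite addNr => i2.
apply/eqP; rewrite -subr_eq0; apply/eqP.
(* The three zeros are replaced by [E1], [E2] and [i2]: half the difference of the first two is u -
   cv up to a multiple of i^2 + 1, which the third removes. *)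
transitivity ((0 - 0 - 0 * (- cu + cv - u + v)) / 2%:R : C); last by field.
by rewrite -{1}E1 -{1}E2 -{1}i2; field.
Qed.

Lemma dual_mulE v w x :
  dual_mul v w x = tlift (fun x1 x2 => (v x1 : C) * w x2 : C^o) (D x).
Proof.
rewrite linfunE // => k y z; rewrite linearP.
by apply: tlift_linear => a r t t'; rewrite linearP mulrDr mulrCA.
Qed.

Lemma dual_starE w a : dual_star w a = (w (hstar (S a)) : C)^*.
Proof.
rewrite linfunE // => k y z; rewrite linearP hstar_antilin // linearP /=.
by rewrite rmorphD rmorphM /= conjK.
Qed.

Lemma dual_antipodeE w a : dual_antipode G w a = w (S a).
Proof.
have l w' : linear (fun a : G => (w' : dual G) (S a)) by move=> k y z; rewrite !linearP.
rewrite linfunE; first exact: (linfunE (l w)).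
move=> k u v; apply/lfunP => y.
by rewrite !lfunE /= !lfunE /= !(linfunE (l _)) !lfunE /= !lfunE.
Qed.

Lemma dual_counitE w : dual_counit G w = w hone.
Proof. by rewrite linfunE // => k u v; rewrite !lfunE /= !lfunE. Qed.

Lemma dual_haarE w : dual_haar G w = h (haar_elt G) * eps (F^-1%VF w) :> C.
Proof.
rewrite linfunE // => k u v; rewrite !linearP /= -/(eps _).
by rewrite mulrDr; congr (_ + _); rewrite mulrCA.
Qed.

Lemma dual_coprodE w : dual_coprod G w = \sum_(k < \dim (fullv : {vspace G}))
      ((linfun (coord (vbasis (fullv : {vspace G})) k : G -> C^o) : dual G)
       ⊗ (linfun (fun c : G => w (hmul (vbasis fullv)`_k c)) : dual G)).
Proof.
rewrite linfunE // => r u v; rewrite scaler_sumr -big_split /=; apply: eq_bigr => k _.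
rewrite -tpureZr -tpureDr; congr (_ ⊗ _).
have l w' : linear (fun c : G => (w' : dual G) (hmul (vbasis fullv)`_k c)).
  by move=> q y z; rewrite mDr mZr linearP.
by apply/lfunP => y; rewrite !lfunE /= !lfunE /= !(linfunE (l _)) !lfunE /= !lfunE.
Qed.

Lemma dual_mul_bilin : bilin (@dual_mul R G).
Proof.
split=> [w|w] k u v; apply/lfunP => y; rewrite !lfunE /= lfunE /= !dual_mulE;
  rewrite scaler_sumr -big_split /=; apply: eq_bigr => i _; rewrite !lfunE /= !lfunE /=.
  by rewrite mulrDl -mulrA.
by rewrite mulrDr mulrCA.
Qed.

Lemma dual_star_data : star_data (dual G).
Proof.
split; first exact: dual_mul_bilin.
- move=> w; apply/lfunP => x; rewrite dual_mulE.
  rewrite -[in RHS](fqg_counitr hG x) (tliftE _ _ (g := w)); last exact: linearP.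
  by apply: eq_tlift => x1 x2; rewrite linearZ mulrC.
- move=> k u v; apply/lfunP => x; rewrite !lfunE /= !lfunE /= !dual_starE.
  by rewrite !lfunE /= !lfunE /= rmorphD rmorphM.
- move=> w; apply/lfunP => x; rewrite !dual_starE conjK.
  by rewrite (fqg_antipode_star hG) SK hstarK.
Qed.

(** At x the left side is the sum of h(S(b_1) a) h(x b_2), the right side that of h(x_1 a) h(x_2 b).
    Strong invariance, after applying h(. a), moves the coproduct from b to x. *)
Lemma fourier_convol a b : F (convol a b) = dual_mul (F a) (F b).
Proof.
apply/lfunP => x; rewrite dual_mulE FE.
have := congr1 (fun y => h (hmul y a)) (strong_invariance hG b x).
have l : linear (fun y => h (hmul y a) : C^o).
  by move=> k y z; rewrite mDl mZl hD hZ.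
rewrite !(tliftE _ _ l) => E.
rewrite (tliftE _ _ (g := fun y => h (hmul x y) : C^o)); last first.
  by move=> k y z; rewrite mDr mZr hD hZ.
transitivity (tlift (fun b1 b2 => h (hmul (h (hmul b2 x) *: S b1) a) : C^o) (D b)).
  by apply: eq_tlift => b1 b2; rewrite mZr mZl !hZ mulrC [h (hmul b2 x)]hC.
rewrite E; apply: eq_tlift => x1 x2.
by rewrite mZl hZ !FE [h (hmul x2 b)]hC mulrC.
Qed.

Lemma fourier_haar_elt : F (haar_elt G) = h (haar_elt G) *: (hone : dual G).
Proof.
by apply/lfunP => x; rewrite lfunE /= FE (haar_eltP hG).2 hZ mulrC.
Qed.

Lemma fourier_convol_adj a : F (convol_adj a) = dual_star (F a).
Proof.
apply/lfunP => x; rewrite dual_starE !FE -haar_star hstarM // hstarK //.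
by rewrite [RHS]hC; apply/esym/haar_antipode_mul.
Qed.

Lemma fourier_antipode a : F (S a) = dual_antipode G (F a).
Proof. by apply/lfunP => x; rewrite dual_antipodeE !FE; apply/esym/haar_antipode_mul. Qed.

Lemma fourier_star a : F (hstar a) = convol_adj (F a : dual G).
Proof.
transitivity (dual_antipode G (dual_star (F a))); last by [].
by rewrite -fourier_convol_adj -fourier_antipode SK.
Qed.

(** F(1) is h itself, and the invariance of h makes it a two-sided integral of the dual with counit
    h(1) = 1. Any e meeting the description equals it, since the product F(1) e is both e and
    F(1). *)
Lemma fourier_hone : F hone = haar_elt (dual G).
Proof.
have P1 : counit (dual G) (F hone) = 1.
  by rewrite [LHS]dual_counitE FE hmulr1 // /h fqg_haar1.
have Pl (w : dual G) : hmul w (F hone : dual G) = counit (dual G) w *: (F hone : dual G).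
  apply/lfunP => x; rewrite [counit _ _]dual_counitE [LHS]dual_mulE lfunE /= FE hmulr1 //.
  transitivity (w (h x *: hone)); last by rewrite linearZ; apply: mulrC.
  rewrite -(fqg_haarr hG) (tliftE _ _ (g := w)); last exact: linearP.
  by apply: eq_tlift => x1 x2; rewrite FE hmulr1 // linearZ; apply: mulrC.
have Pr (w : dual G) : hmul (F hone : dual G) w = counit (dual G) w *: (F hone : dual G).
  apply/lfunP => x; rewrite [counit _ _]dual_counitE [LHS]dual_mulE lfunE /= FE hmulr1 //.
  transitivity (w (h x *: hone)); last by rewrite linearZ; apply: mulrC.
  rewrite -(fqg_haarl hG) (tliftE _ _ (g := w)); last exact: linearP.
  by apply: eq_tlift => x1 x2; rewrite FE hmulr1 // linearZ.
rewrite /haar_elt; case: xgetP => [e _ [e1 ew]|/(_ (F hone)) []]; last by [].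
have := ew (F hone); rewrite P1 scale1r => <-.
by rewrite Pr e1 scale1r.
Qed.

Lemma dual_coord w :
  \sum_(k < _) w (vbasis fullv)`_k *:
    (linfun (coord (vbasis fullv) k : G -> C^o) : dual G) = w.
Proof.
apply/lfunP => x; rewrite sum_lfunE [x in RHS]coord_vbasisT linear_sum /=.
apply: eq_bigr => k _; rewrite !lfunE /= lfunE /= linearZ; apply: mulrC.
Qed.

Lemma counit_convol a b : counit G (convol a b) = h (hmul (S b) a).
Proof.
rewrite (tliftE _ _ (g := counit G)); last exact: linearP.
rewrite -[b in RHS](fqg_counitr hG) (tliftE _ _ (g := fun y => h (hmul (S y) a) : C^o)).
  by apply: eq_tlift => b1 b2; rewrite !linearZ mZl hZ; apply: mulrC.
by move=> k y z; rewrite linearP mDl mZl hD hZ.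
Qed.

(** At y, the dual-basis sum in [dual_coprod] collapses to F(yb), because F(b) at e_k y is F(yb) at
    e_k. What remains is the dual Haar state of F(S(yb)) F(a), the transform of a convolution; for
    the Haar element e it equals h(e) h(S(a) S(yb)) = h(e) h(yba). *)
Lemma dual_convol a b :
  convol (F a : dual G) (F b) = h (haar_elt G) *: (F (hmul b a) : dual G).
Proof.
have Pl : linear (fun u : dual G => dual_haar G (dual_mul (dual_antipode G u) (F a))).
  by move=> k u v; rewrite linearP (dual_mul_bilin.1 (F a)) linearP.
transitivity (tlift (fun w1 w2 : dual G =>
    dual_haar G (dual_mul (dual_antipode G w1) (F a)) *: w2) (dual_coprod G (F b))).
  by [].
have bf : balanced (fun w1 w2 : dual G =>
    dual_haar G (dual_mul (dual_antipode G w1) (F a)) *: w2).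
  apply: bilin_balanced; split=> [w k u v|w k u v].
    by rewrite Pl scalerDl scalerA.
  by rewrite scalerDr !scalerA [_ * k]mulrC.
rewrite dual_coprodE (morph_sum (tliftD bf)); apply/lfunP => y; rewrite sum_lfunE.
transitivity (dual_haar G (dual_mul (dual_antipode G (F (hmul y b))) (F a))).
  rewrite -[in RHS](dual_coord (F (hmul y b))) (morph_sum (linD Pl)).
  apply: eq_bigr => k _; rewrite tlift_pure // scale_lfunE (linZ Pl).
  rewrite [X in _ *: X]linfunE; first by rewrite !FE hmulA //; apply: mulrC.
  by move=> q u v; rewrite mDr mZr linearP.
rewrite -fourier_antipode -fourier_convol dual_haarE fourierK // lfunE /= FE.
rewrite /eps counit_convol; congr (_ * _).
by rewrite [LHS]haar_antipode_mul // SK [LHS]hC hmulA.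
Qed.

End Dual.

(** * Quantum families *)

Section Antilinear.
Variable R : realType.
Local Notation C := R[i].
Implicit Types (A : vectType C) (B : cstarType R).

Lemma antilinD (U V : lmodType C) (f : U -> V) : antilin f -> {morph f : x y / x + y}.
Proof. by move=> lf x y; rewrite -[x]scale1r lf rmorph1 !scale1r. Qed.

Lemma antilinZ (U V : lmodType C) (f : U -> V) (k : C) x :
  antilin f -> f (k *: x) = k^* *: f x.
Proof.
move=> lf; have f0 : f 0 = 0 by apply: (addrI (f 0)); rewrite -antilinD // !addr0.
by rewrite -[k *: x]addr0 lf f0 addr0.
Qed.

Lemma adj_antilin B : antilin (@adj R B).
Proof. by move=> k x y; rewrite adj_antilinear. Qed.

Lemma tmap_antilin_balanced (A A' : vectType C) (B B' : lmodType C)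
    (f : A -> A') (g : B -> B') :
  antilin f -> antilin g -> balanced (fun a b => f a ⊗ g b).
Proof.
move=> lf lg; split=> [b a a'|a b b'|k a b].
- by rewrite antilinD // tpureDl.
- by rewrite antilinD // tpureDr.
- by rewrite (antilinZ _ _ lf) (antilinZ _ _ lg) tpureZl tpureZr.
Qed.

Lemma mulr_bilin B : bilin (fun a b : B => a * b).
Proof.
split=> [b|a] k x y; first by rewrite mulrDl scalerAl.
by rewrite mulrDr scalerAr.
Qed.

End Antilinear.

Section LinearSpan.
Variable K : fieldType.
Implicit Types U V : lmodType K.

Lemma lspan_in V (X : set V) x : X x -> lspan X x.
Proof. by move=> Xx; exists 1%N, (fun=> 1), (fun=> x); rewrite big_ord1 scale1r. Qed.

Lemma lspanD V (X : set V) x y : lspan X x -> lspan X y -> lspan X (x + y).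
Proof.
move=> [n [c [v [vX ->]]]] [m [d [w [wX ->]]]].
exists (n + m)%N, (fun k => match fintype.split k with inl i => c i | inr j => d j end),
  (fun k => match fintype.split k with inl i => v i | inr j => w j end).
split=> [k|]; first by case: (fintype.split k).
rewrite big_split_ord; congr (_ + _); apply: eq_bigr => k _.
  by rewrite (unsplitK (inl k)).
by rewrite (unsplitK (inr k)).
Qed.

Lemma lspanZ V (X : set V) k x : lspan X x -> lspan X (k *: x).
Proof.
move=> [n [c [v [vX ->]]]]; exists n, (fun i => k * c i), v; split=> //.
by rewrite scaler_sumr; apply: eq_bigr => i _; rewrite scalerA.
Qed.

Lemma lspan_sum V (X : set V) n (v : 'I_n -> V) :
  (forall k, lspan X (v k)) -> lspan X (\sum_k v k).
Proof.
move=> vX; elim/big_ind: _ => [|x y|k _]; [|exact: lspanD|exact: vX].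
by exists 0%N, (fun=> 0), (fun=> 0); rewrite big_ord0; split=> // -[].
Qed.

Lemma lspan_linear U V (f : U -> V) (X : set U) (Y : set V) x : linear f ->
  (forall u, X u -> lspan Y (f u)) -> lspan X x -> lspan Y (f x).
Proof.
move=> lf fX [n [c [v [vX ->]]]]; rewrite (morph_sum (linD lf)).
by apply: lspan_sum => k; rewrite (linZ lf); apply/lspanZ/fX.
Qed.

End LinearSpan.

(** * Antipode and push-forward of quantum families *)

Section StarData.
Variables (R : realType) (G : hopf_data R).
Hypothesis sG : star_data G.

Lemma convol_bilin : bilin (@convol R G).
Proof.
split=> [b|a] k x y; last first.
  rewrite /convol linearP (tlift_linear _) // => u q v w.
  by rewrite scalerDr !scalerA mulrC.
rewrite /convol scaler_sumr -big_split /=; apply: eq_bigr => i _.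
by rewrite (sd_mul sG).2 linearP scalerDl scalerA.
Qed.

Lemma convol_adj_antilin : antilin (@convol_adj R G).
Proof. by move=> k x y; rewrite /convol_adj (sd_star sG) linearP. Qed.

(** S is the composite of the two adjoints, each intertwined by alpha; on B the two [adj] cancel. *)
Lemma quantum_family_antipode (B : cstarType R) (alpha : G -> tens G B) x :
  quantum_family alpha ->
  alpha (antipode G x) = tmap (antipode G) idfun (alpha x).
Proof.
move=> qa; have -> : antipode G x = convol_adj (hstar x).
  by rewrite /convol_adj (sd_starK sG).
rewrite -(qf_convol_adj qa) (qf_star qa) tmap_comp.
  by apply: eq_tmap => y /=; rewrite ?adjK // /convol_adj (sd_starK sG).
exact: (tmap_antilin_balanced convol_adj_antilin (@adj_antilin _ _)).
Qed.

Lemma tmul_hone (B : cstarType R) (t : tens G B) (b : B) :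
  tmul (@hmul R G) *%R t (hone ⊗ b) = tmap idfun ( *%R^~ b) t.
Proof.
apply: eq_tlift => a b'; rewrite tlift_pure ?sd_mulr1 //.
exact/bilin_balanced/tmul_bilin/mulr_bilin/sd_mul.
Qed.

(** Supplies the families to which the uniqueness clause of the universal property is applied. The
    Podleś condition needs an argument because M may fail to be surjective. *)
Lemma quantum_family_push (B B' : cstarType R) (alpha : G -> tens G B) (M : B -> B') :
  quantum_family alpha -> star_hom M -> quantum_family (tmap idfun M \o alpha).
Proof.
move=> qa hM; have lM := star_hom_linear hM.
have bM (A' : vectType R[i]) : balanced (fun a b => (a : A') ⊗ M b).
  exact: tmap_balanced.
have lt : linear (tmap idfun M : tens G B -> tens G B') := tmap_linear _ lM.
have pM (m : G -> G -> G) t t' : bilin m ->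
    tmap idfun M (tmul m *%R t t') = tmul m *%R (tmap idfun M t) (tmap idfun M t').
  move=> bm; rewrite tmul_tmap //; last exact: mulr_bilin.
  rewrite tmap_tmul //; apply: eq_tlift => a b; apply: eq_tlift => a' b'.
  by rewrite (star_homM hM).
have ps (s : G -> G) t : antilin s ->
    tmap idfun M (tmap s adj t) = tmap s adj (tmap idfun M t).
  move=> ls; rewrite !tmap_comp //; last first.
    exact: (tmap_antilin_balanced ls (@adj_antilin _ _)).
  by apply: eq_tmap => b //=; rewrite (star_hom_adj hM).
split=> [|| x y | x || x y | x |] /=.
- exact: (lin_comp lt (qf_linear qa)).
- by rewrite (qf_one qa) /tmap tlift_pure // (star_hom1 hM).
- by rewrite (qf_mul qa) pM //; apply: sd_mul.
- by rewrite (qf_star qa) ps //; apply: sd_star.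
- rewrite predeqE => t; split=> // _.
  have lr (b : B') : linear (tmap idfun ( *%R^~ b) : tens G B' -> tens G B').
    exact/tmap_linear/(mulr_bilin _).1.
  rewrite [t]tens_sum; apply: lspan_sum => i; set e := _`_i.
  (* The Podleś condition of alpha reaches e ⊗ 1, which M preserves; right multiplication by [t i]
     is absorbed into the factor 1 ⊗ b. *)
  have -> : e ⊗ t i = tmap idfun ( *%R^~ (t i)) (tmap idfun M (e ⊗ 1)).
    rewrite [tmap _ M _]tlift_pure // (star_hom1 hM) /tmap tlift_pure ?mul1r //.
    exact/tmap_balanced/(mulr_bilin _).1.
  apply: (lspan_linear (lr _)); last first.
    have te : [set: tens G B] (e ⊗ 1) by [].
    rewrite -(qf_podles qa) in te.
    apply: (lspan_linear lt (Y := [set t | exists x b,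
      t = tmul (@hmul R G) *%R (tmap idfun M (alpha x)) (hone ⊗ b)]) _ te).
    move=> _ [x [b ->]]; apply: lspan_in; exists x, (M b).
    rewrite !tmul_hone !tmap_comp //; last exact/tmap_balanced/(mulr_bilin _).1.
    by apply: eq_tmap => c //=; rewrite (star_homM hM).
  move=> _ [x [b ->]]; apply: lspan_in; exists x, (b * t i).
  rewrite !tmul_hone tmap_comp //; last exact/tmap_balanced/(mulr_bilin _).1.
  by apply: eq_tmap => c //=; rewrite mulrA.
- by rewrite (qf_convol qa) pM //; apply: convol_bilin.
- by rewrite -(qf_convol_adj qa) -ps //; apply: convol_adj_antilin.
- by rewrite (qf_haar_elt qa) /tmap tlift_pure // (star_hom1 hM).
Qed.

End StarData.

(** * Transport along the Fourier transform *)

(* The pattern of the Fourier transform f = F and of g = F o S, stated so that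
   exchanging (f, f', g, g') with (g', g, f', f) exchanges the roles of G and H. *)
Record fourier_pair (R : realType) (G H : hopf_data R)
    (f : G -> H) (f' : H -> G) (g : G -> H) (g' : H -> G) : Prop := {
  fp_lin : [/\ linear f, linear f', linear g & linear g'] ;
  fp_can : [/\ cancel f f', cancel f' f, cancel g g' & cancel g' g] ;
  fp_convol : exists2 k : R[i], k != 0 &
    forall a b, f (convol a b) = k *: hmul (f a) (f b) ;
  fp_haar_elt : exists2 k : R[i], k != 0 & f (haar_elt G) = k *: hone ;
  fp_convol_adj : forall a, f (convol_adj a) = hstar (f a) ;
  fp_mul : exists2 k : R[i], k != 0 &
    forall a b, g (hmul a b) = k *: convol (g a) (g b) ;
  fp_one : exists2 k : R[i], k != 0 & g hone = k *: haar_elt H ;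
  fp_star : forall a, g (hstar a) = convol_adj (g a)
}.

Section Transport.
Variable R : realType.
Local Notation C := R[i].

Lemma fourier_pair_sym (G H : hopf_data R) (f : G -> H) f' g g' :
  fourier_pair f f' g g' -> fourier_pair g' g f' f.
Proof.
case=> -[lf lf' lg lg'] [fK fK' gK gK'] [c c0 fc] [e e0 fe] fa [m m0 gm] [u u0 gu] gs.
split=> //.
- exists m^-1; first by rewrite invr_eq0.
  move=> a b; apply: (can_inj gK); rewrite gK' (linZ lg) gm !gK'.
  by rewrite scalerA mulVf // scale1r.
- exists u^-1; first by rewrite invr_eq0.
  by apply: (can_inj gK); rewrite gK' (linZ lg) gu scalerA mulVf // scale1r.
- by move=> a; apply: (can_inj gK); rewrite gK' gs gK'.
- exists c^-1; first by rewrite invr_eq0.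
  move=> a b; apply: (can_inj fK); rewrite fK' (linZ lf) fc !fK'.
  by rewrite scalerA mulVf // scale1r.
- exists e^-1; first by rewrite invr_eq0.
  by apply: (can_inj fK); rewrite fK' (linZ lf) fe scalerA mulVf // scale1r.
- by move=> a; apply: (can_inj fK); rewrite fK' fa fK'.
Qed.

Section Family.
Variables (A A' : vectType C) (B : cstarType R).
Variables (f : A -> A') (alpha : A -> tens A B) (beta : A' -> tens A' B).
Hypotheses (lf : linear f) (lb : linear beta).
Hypothesis beta_f : forall a, beta (f a) = tmap f idfun (alpha a).

(** [beta] is the conjugate of [alpha] by f, so an axiom passes from one to the other whenever f
    matches the structures; a nonzero constant k in the matching cancels by linearity of [beta]. *)
Lemma transport_elt (k : C) u v : k != 0 -> f u = k *: v ->
  alpha u = u ⊗ 1 -> beta v = v ⊗ 1.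
Proof.
move=> k0 fu au; apply: (scalerI k0).
rewrite -(linZ lb) -fu beta_f au /tmap tlift_pure; last exact: tmap_balanced.
by rewrite fu tpureZl.
Qed.

Lemma transport_mul (k : C) (m : A -> A -> A) (m' : A' -> A' -> A') : k != 0 ->
  bilin m' -> (forall a b, f (m a b) = k *: m' (f a) (f b)) ->
  (forall a b, alpha (m a b) = tmul m *%R (alpha a) (alpha b)) ->
  forall a b, beta (m' (f a) (f b)) = tmul m' *%R (beta (f a)) (beta (f b)).
Proof.
move=> k0 bm fm am a b; apply: (scalerI k0).
rewrite -(linZ lb) -fm !beta_f am tmap_tmul // tmul_tmap //; last exact: mulr_bilin.
rewrite scaler_sumr; apply: eq_bigr => i _; rewrite scaler_sumr; apply: eq_bigr => j _.
by rewrite fm tpureZl.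
Qed.

Lemma transport_star (s : A -> A) (s' : A' -> A') : antilin s' ->
  (forall a, f (s a) = s' (f a)) -> (forall a, alpha (s a) = tmap s adj (alpha a)) ->
  forall a, beta (s' (f a)) = tmap s' adj (beta (f a)).
Proof.
move=> ls fs asE a; rewrite -fs !beta_f asE !tmap_comp.
- by apply: eq_tmap => // b /=; rewrite fs.
- exact: tmap_antilin_balanced ls (@adj_antilin _ _).
- exact: tmap_balanced.
Qed.

End Family.

(** Through f the convolution axioms of alpha become algebra axioms of beta, and through g the
    algebra axioms become convolution axioms. Hence beta must be the conjugate of alpha by both
    maps. *)
Lemma quantum_family_transport (G H : hopf_data R) (B : cstarType R)
    (f : G -> H) f' g g' (alpha : G -> tens G B) (beta : H -> tens H B) :
  star_data G -> star_data H -> fourier_pair f f' g g' ->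
  (forall a, beta (f a) = tmap f idfun (alpha a)) ->
  (forall a, beta (g a) = tmap g idfun (alpha a)) ->
  quantum_family alpha -> quantum_family beta.
Proof.
move=> sG sH [[lf lf' lg lg'] [fK fK' gK gK'] [c c0 fc] [e e0 fe]
  fa [m m0 gm] [u u0 gu] gs] bf bg qa.
have ltf : linear (tmap f idfun : tens G B -> tens H B) by exact: tmap_linear.
have lb : linear beta.
  by move=> k x y; rewrite -(fK' x) -(fK' y) -lf !bf (qf_linear qa) ltf.
split=> //.
- exact: (transport_elt lf lb bf e0 fe (qf_haar_elt qa)).
- move=> x y; rewrite -(fK' x) -(fK' y).
  exact: (transport_mul lf lb bf c0 (sd_mul sH) fc (qf_convol qa)).
- move=> x; rewrite -(fK' x).
  apply: (transport_star lf bf (sd_star sH) fa) => a.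
  by rewrite -(qf_convol_adj qa).
- rewrite predeqE => t; split=> // _.
  (* t is pulled back along f', written in the Podleś span of alpha and pushed forward; f commutes
     with right multiplication by 1 ⊗ b, which touches only the right leg. *)
  have -> : t = tmap f idfun (tmap f' idfun t).
    rewrite tmap_comp; last exact: tmap_balanced.
    by rewrite -[LHS]tmap_id; apply: eq_tmap => x //=; rewrite fK'.
  have te : [set: tens G B] (tmap f' idfun t) by [].
  rewrite -(qf_podles qa) in te.
  apply: (lspan_linear ltf _ te) => _ [x [b ->]].
  apply: lspan_in; exists (f x), b; rewrite !tmul_hone // bf.
  by rewrite !tmap_comp //; apply/tmap_balanced => //; apply: (mulr_bilin _).1.
- move=> x y; rewrite -(gK' x) -(gK' y).
  exact: (transport_mul lg lb bg m0 (convol_bilin sH) gm (qf_mul qa)).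
- move=> x; rewrite -(gK' x); apply/esym.
  exact: (transport_star lg bg (convol_adj_antilin sH) gs (qf_star qa)).
- exact: (transport_elt lg lb bg u0 gu (qf_one qa)).
Qed.

End Transport.

(** * Quantum families on G and on its dual, and the resulting isomorphism *)

Section DualFamily.
Variables (R : realType) (G : hopf_data R).
Hypothesis hG : finite_quantum_group G.
Local Notation S := (antipode G).
Local Notation F := (fourier G).
Local Notation F' := (fourier G)^-1%VF.

Let FK : cancel F F' := fourierK hG.
Let F'K : cancel F' F := fourierVK hG.
Let SK : involutive S := fqg_antipodeK hG.

(** [dual_convol] reverses the factors and S reverses them again, so F after S keeps their order. *)
Lemma fourier_fourier_pair :
  @fourier_pair R G (dual G) F F' (F \o S) (S \o F').
Proof.
have h0 := haar_haar_elt_neq0 hG.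
split=> [|||||||a] /=.
- by split=> k x y /=; rewrite ?linearP // [_ (_ + _)]linearP linearP.
- by split=> x //=; rewrite ?FK // SK ?FK ?F'K.
- exists 1; first exact: oner_neq0.
  by move=> a b; rewrite scale1r; apply: fourier_convol.
- by exists (haar G (haar_elt G)) => //; apply: fourier_haar_elt.
- by move=> a; apply: fourier_convol_adj.
- exists (haar G (haar_elt G))^-1; first by rewrite invr_eq0.
  move=> a b; rewrite [convol _ _](dual_convol hG) scalerA mulVf // scale1r.
  by rewrite antipode_hmul.
- exists 1; first exact: oner_neq0.
  rewrite scale1r -fourier_hone //; congr (F _).
  by rewrite -[LHS](hmul1r hG) -{1}[hone]SK -antipode_hmul // hmul1r // SK.
- by rewrite fqg_antipode_star // -fourier_star.
Qed.

(** Conjugating by F also conjugates by F after S, because alpha commutes with S. *)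
Lemma quantum_family_dual (B : cstarType R) (alpha : G -> tens G B) :
  quantum_family alpha ->
  quantum_family (tmap (F : G -> dual G) idfun \o alpha \o F' : dual G -> tens (dual G) B).
Proof.
move=> qa; apply: (quantum_family_transport (finite_star_data hG) (dual_star_data hG)
  fourier_fourier_pair) (qa) => a /=; first by rewrite FK.
rewrite FK (quantum_family_antipode (finite_star_data hG)) // tmap_comp //.
by apply: tmap_balanced => //; apply: linearP.
Qed.

(** With the pair reversed, S after F' takes the part of f. The family beta commutes with the dual
    antipode, which F' intertwines with S. *)
Lemma quantum_family_predual (B : cstarType R) (beta : dual G -> tens (dual G) B) :
  quantum_family beta ->
  quantum_family (tmap (F' : dual G -> G) idfun \o beta \o F : G -> tens G B).
Proof.
move=> qb; apply: (quantum_family_transport (dual_star_data hG) (finite_star_data hG)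
  (fourier_pair_sym fourier_fourier_pair)) (qb) => a /=; last by rewrite F'K.
rewrite fourier_antipode // F'K.
rewrite (quantum_family_antipode (dual_star_data hG)) // tmap_comp //.
  apply: eq_tmap => // w /=; apply: (can_inj FK).
  by rewrite F'K fourier_antipode // F'K.
by apply: tmap_balanced => //; apply: linearP.
Qed.

End DualFamily.

(** Both maps factor the same pushed-forward family through the universal one. *)
Lemma qAut_hom_eq (R : realType) (G : hopf_data R) (Q : qAut G) (B : cstarType R)
    (L1 L2 : Q -> B) : star_data G -> star_hom L1 -> star_hom L2 ->
  (forall x, tmap idfun L1 (qAut_act Q x) = tmap idfun L2 (qAut_act Q x)) -> L1 = L2.
Proof.
move=> sG h1 h2 e; have q1 := quantum_family_push sG (qAut_family Q) h1.
have [L [_ Lu]] := qAut_universal Q q1.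
by rewrite -(Lu L1) // -(Lu L2).
Qed.

Theorem proposition2p12 (R : realType) (G : hopf_data R)
    (hG : finite_quantum_group G) (Q : qAut G) (Q' : qAut (dual G)) :
  exists L : Q -> Q',
    cqg_iso L /\
    forall a : G, qAut_act Q' (to_dual a) = tmap (K := R[i]) (@to_dual R G) L (qAut_act Q a).
Proof.
have sG := finite_star_data hG; have sD := dual_star_data hG.
pose F : G -> dual G := fourier G; pose F' : dual G -> G := (fourier G)^-1%VF.
have FK : cancel F F' := fourierK hG.
have F'K : cancel F' F := fourierVK hG.
have lF : linear F by exact: linearP.
have lF' : linear F' by exact: linearP.
have TK (B : cstarType R) : cancel (tmap F (@idfun B)) (tmap F' idfun).
  move=> t; rewrite tmap_comp; last exact: tmap_balanced.
  by rewrite -[RHS]tmap_id; apply: eq_tmap => //= x; rewrite FK.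
have TK' (B : cstarType R) : cancel (tmap F' (@idfun B)) (tmap F idfun).
  move=> t; rewrite tmap_comp; last exact: tmap_balanced.
  by rewrite -[RHS]tmap_id; apply: eq_tmap => //= x; rewrite F'K.
(* L comes from the universal property of Q for the family of Q' carried back to G, and L' from the
   opposite choice. *)
have [L [[hL EL] _]] := qAut_universal Q (quantum_family_predual hG (qAut_family Q')).
have [L' [[hL' EL'] _]] := qAut_universal Q' (quantum_family_dual hG (qAut_family Q)).
have lL := star_hom_linear hL; have lL' := star_hom_linear hL'.
have actL a : qAut_act Q' (F a) = tmap F L (qAut_act Q a).
  rewrite -[LHS]TK' -[tmap F' _ _]/((tmap F' idfun \o qAut_act Q' \o F) a) EL.
  by rewrite tmap_comp //; apply: tmap_balanced.
have actL' w : qAut_act Q (F' w) = tmap F' L' (qAut_act Q' w).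
  rewrite -[LHS]TK -[tmap F _ _]/((tmap F idfun \o qAut_act Q \o F') w) EL'.
  by rewrite tmap_comp //; apply: tmap_balanced.
exists L; split; last exact: actL.
split=> //.
(* Both composites fix the universal action, as the identity does. *)
- exists L' => b.
    rewrite -[RHS]/(idfun b) -[LHS]/((L' \o L) b); congr (_ b).
    apply: (qAut_hom_eq sG (star_hom_comp hL' hL) (@star_hom_id _ _)) => a.
    rewrite tmap_id -[in RHS](FK a) actL' actL tmap_comp; last exact: tmap_balanced.
    by apply: eq_tmap => // x /=; rewrite FK.
  rewrite -[RHS]/(idfun b) -[LHS]/((L \o L') b); congr (_ b).
  apply: (qAut_hom_eq sD (star_hom_comp hL hL') (@star_hom_id _ _)) => w.
  rewrite tmap_id -[in RHS](F'K w) actL actL' tmap_comp; last exact: tmap_balanced.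
  by apply: eq_tmap => // x /=; rewrite F'K.
have [LL hLL] := tensor_hom_exists (cqg_spatial Q) (cqg_spatial Q') hL hL.
exists LL => //; have [hLL' LL1 LL2] := hLL.
have lLL := star_hom_linear hLL'.
have lD' := star_hom_linear (cqg_coprod_hom Q').
have [hl1 hl2 _ _ _] := cqg_spatial Q'.
(* The two homomorphisms from Q to the tensor square of Q' are compared on the universal action. *)
apply: (qAut_hom_eq sG).
- exact: star_hom_comp hLL' (cqg_coprod_hom Q).
- exact: star_hom_comp (cqg_coprod_hom Q') hL.
move=> a; apply: (can_inj (@TK _)).
(* With F applied to the left leg, both sides reduce to this twofold action: one by [qAut_action]
   for Q, the other by [qAut_action] for Q' together with [actL]. *)
transitivity (tlift (fun y b => tmap F (fun c => leg1 (L c) * leg2 (L b))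
    (qAut_act Q y)) (qAut_act Q a)).
  transitivity (tmap F idfun (tmap idfun LL (tmap idfun (@cqg_coprod R Q) (qAut_act Q a)))).
    by congr tmap; rewrite tmap_comp //; apply: tmap_balanced.
  rewrite qAut_action tmap_comp; last exact: tmap_balanced.
  rewrite (tliftE _ _ (g := tmap F LL)); last exact: tmap_linear.
  apply: eq_tlift => y b; rewrite tmap_comp; last exact: tmap_balanced.
  by apply: eq_tmap => // c /=; rewrite (star_homM hLL') LL1 LL2.
apply/esym; transitivity (tmap idfun (@cqg_coprod R Q') (qAut_act Q' (F a))).
  by rewrite actL !tmap_comp //; apply: tmap_balanced.
have lr b : linear (fun c : Q' => leg1 c * leg2 b).
  by move=> k c d; rewrite (star_hom_linear hl1) mulrDl scalerAl.
rewrite qAut_action actL tlift_tmap.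
  by apply: eq_tlift => y b; rewrite actL tmap_comp //; apply: tmap_balanced.
apply: bilin_balanced; split=> [b|w] k x y.
  by rewrite (qf_linear (qAut_family Q')) tmap_linear.
rewrite scaler_sumr -big_split /=; apply: eq_bigr => i _.
by rewrite (star_hom_linear hl2) mulrDr -scalerAr tpureDr tpureZr.
Qed.
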